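(* Let $\mathrm{L}$ be a relational $\omega$-signature and let $T,S$ be sets of $\mathrm{L}_{\infty\omega}$-formulae. The following are equivalent: (1) $T\models_{\mathrm{Sh}}S$; (2) $T\models_{\mathrm{BVM}}S$; (3) $T\vdash S$.
   Context: A relational $\omega$-signature $\mathrm{L}$ consists of finitary relation symbols and constant symbols (no function symbols). For a cardinal $\kappa$, $\mathrm{L}_{\kappa\omega}$-formulae are built from first-order atomic formulae by closing under $\neg$, under $\bigwedge\Phi$ and $\bigvee\Phi$ for sets $\Phi$ of fewer than $\kappa$ formulae whose free variables are jointly finitely many, and under $\forall V$, $\exists V$ for finite sets $V$ of variables; $\mathrm{L}_{\infty\omega}=\bigcup_\kappa \mathrm{L}_{\kappa\omega}$. (Similarly $\mathrm{L}_{\kappa\lambda}$ allows fewer than $\lambda$ free variables and quantification over sets of fewer than $\lambda$ variables, and $\mathrm{L}_{\infty\infty}=\bigcup_{\kappa,\lambda}\mathrm{L}_{\kappa\lambda}$.) Boolean valued models: for a complete Boolean algebra $\mathsf{B}$, a $\mathsf{B}$-valued model $\mathcal{M}$ for $\mathrm{L}$ consists of a nonempty set $M$, a map $(\tau,\sigma)\mapsto[\![\tau=\sigma]\!]\in\mathsf{B}$, for each $n$-ary relation symbol $R$ a map $M^n\to\mathsf{B}$, $\bar\tau\mapsto[\![R(\bar\tau)]\!]$, and an element $c^{\mathcal M}\in M$ for each constant $c$, such that $[\![\tau=\tau]\!]=1$, $[\![\tau=\sigma]\!]=[\![\sigma=\tau]\!]$, $[\![\tau=\sigma]\!]\wedge[\![\sigma=\pi]\!]\le[\![\tau=\pi]\!]$,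 and $\bigwedge_i[\![\tau_i=\sigma_i]\!]\wedge[\![R(\bar\tau)]\!]\le[\![R(\bar\sigma)]\!]$. The value of a formula under an assignment of elements of $M$ to its free variables is defined recursively: atomic formulae as given, $[\![\neg\phi]\!]=\neg[\![\phi]\!]$, $[\![\bigwedge\Phi]\!]=\bigwedge_{\phi\in\Phi}[\![\phi]\!]$, $[\![\bigvee\Phi]\!]=\bigvee_{\phi\in\Phi}[\![\phi]\!]$, $[\![\forall V\phi]\!]$ (resp. $[\![\exists V\phi]\!]$) is the infimum (resp. supremum) of $[\![\phi]\!]$ over all assignments to the variables in $V$. $\mathcal M$ has the mixing property if for every antichain $A\subseteq\mathsf{B}$ and every family $\{\tau_a:a\in A\}\subseteq M$ there is $\tau\in M$ with $a\le[\![\tau=\tau_a]\!]$ for all $a\in A$. $\Gamma\models_{\mathrm{BVM}}\Delta$ means: for every complete Boolean algebra $\mathsf{B}$, every $\mathsf{B}$-valued model $\mathcal M$ and every assignment of the free variables, $[\![\bigwedge\Gamma]\!]\le[\![\bigvee\Delta]\!]$ (with $[\![\bigwedge\emptyset]\!]=1$, $[\![\bigvee\emptyset]\!]=0$). $\Gamma\models_{\mathrm{Sh}}\Delta$ means the same but only for $\mathsf{B}$-valued models with the mixing property. $\Gamma\vdash\Delta$ (for arbitrary sets $\Gamma,\Delta$ of formulae, regarded as built using only $\neg,\bigwedge,\forall$, with $\bigvee,\exists$ as abbreviations) means there is an ordinal-indexed sequence $(s_\alpha)_{\alpha\le\beta}$ of sequents with $s_\beta$ equal to $\Gamma\vdash\Delta$,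 each $s_\alpha$ an axiom or obtained from earlier ones by a rule: Axiom $\Gamma,\phi\vdash\phi,\Delta$; Cut: from $\Gamma,\phi\vdash\Delta$ and $\Gamma'\vdash\phi,\Delta'$ infer $\Gamma,\Gamma'\vdash\Delta,\Delta'$; Substitution: from $\Gamma\vdash\Delta$ infer $\Gamma(\bar w/\bar v)\vdash\Delta(\bar w/\bar v)$; Weakening: from $\Gamma\vdash\Delta$ infer $\Gamma,\Gamma'\vdash\Delta,\Delta'$; Left negation: from $\Gamma\vdash\phi,\Delta$ infer $\Gamma,\neg\phi\vdash\Delta$; Right negation: from $\Gamma,\phi\vdash\Delta$ infer $\Gamma\vdash\neg\phi,\Delta$; Left conjunction: from $\Gamma,\Gamma'\vdash\Delta$ infer $\Gamma,\bigwedge\Gamma'\vdash\Delta$; Right conjunction: from $\Gamma\vdash\phi_i,\Delta$ for all $i\in I$ infer $\Gamma\vdash\bigwedge\{\phi_i:i\in I\},\Delta$; Left quantification: from $\Gamma,\phi(\bar t/\bar v)\vdash\Delta$ infer $\Gamma,\forall\bar v\phi(\bar v)\vdash\Delta$; Right quantification: from $\Gamma\vdash\phi(\bar w/\bar v),\Delta$ infer $\Gamma\vdash\forall\bar v\phi(\bar v),\Delta$, provided no variable of $\bar w$ occurs free in a formula of $\Gamma\cup\Delta\cup\{\phi\}$; Equality 1: $v_\alpha=v_\beta\vdash v_\beta=v_\alpha$; Equality 2: $\bar u=\bar t,\phi(\bar t)\vdash\phi(\bar u)$.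
   Formalization: The calculus for ⊢ is given an additional reflexivity axiom ⊢ v = v (without it v = v is valid but not derivable), and in Right quantification the variables of w̄ are required to be pairwise distinct (otherwise the rule is unsound). *)

(* Defs.v *)
From HB Require Import structures.
From mathcomp Require Import all_boot all_order.
From mathcomp Require Import all_classical wochoice.

Set Implicit Arguments.
Unset Strict Implicit.
Unset Printing Implicit Defensive.

Local Open Scope classical_set_scope.

Record signature := Signature {
  relsym : Type;
  arity : relsym -> nat;
  constsym : Type
}.

(* One universe for the index types of all conjunctions and disjunctions, in
   formulae and in the rules of the calculus. *)
Definition index := Type.

Inductive term (L : signature) (V : Type) : Type :=
| Var of V
| Const of constsym L.
Arguments Var {L V}.
Arguments Const {L V}.

(* [formula L V] has its free variables in [V] and is a representation up to
   renaming of bound variables: a quantifier over a finite set of [n] variables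
   introduces [n] new variables [inr i], so its body lives over [V + 'I_n].
   A set [Phi] of formulae is given as the range of a family indexed by an
   arbitrary type.  The requirement that the free variables of [Phi] be jointly
   finitely many is the predicate [Linfomega] below. *)
Inductive formula (L : signature) (V : Type) : Type :=
| fEq of term L V & term L V
| fRel (R : relsym L) of ('I_(arity R) -> term L V)
| fNot of formula L V
| fAnd (J : index) of (J -> formula L V)
| fOr (J : index) of (J -> formula L V)
| fAll (n : nat) of formula L (V + 'I_n)
| fEx (n : nat) of formula L (V + 'I_n).
Arguments fEq {L V}.
Arguments fRel {L V}.
Arguments fNot {L V}.
Arguments fAnd {L V J}.
Arguments fOr {L V J}.
Arguments fAll {L V} n.
Arguments fEx {L V} n.

Definition term_var L V (t : term L V) : set V :=
  if t is Var x then [set x] else set0.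

Fixpoint free_var L V (phi : formula L V) : set V :=
  match phi with
  | fEq s t => term_var s `|` term_var t
  | fRel R t => \bigcup_i term_var (t i)
  | fNot psi => free_var psi
  | fAnd J f => \bigcup_i free_var (f i)
  | fOr J f => \bigcup_i free_var (f i)
  | fAll n psi => [set x | free_var psi (inl x)]
  | fEx n psi => [set x | free_var psi (inl x)]
  end.

Fixpoint Linfomega L V (phi : formula L V) : Prop :=
  match phi with
  | fEq _ _ => True
  | fRel _ _ => True
  | fNot psi => Linfomega psi
  | fAnd J f => (forall i, Linfomega (f i)) /\
                finite_set (\bigcup_i free_var (f i))
  | fOr J f => (forall i, Linfomega (f i)) /\
               finite_set (\bigcup_i free_var (f i))
  | fAll n psi => Linfomega psi
  | fEx n psi => Linfomega psi
  end.

Definition extend (V W : Type) n (f : V -> W) (g : 'I_n -> W)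
    (x : V + 'I_n) : W :=
  match x with inl v => f v | inr i => g i end.

Definition term_subst L V W (s : V -> term L W) (t : term L V) : term L W :=
  match t with Var x => s x | Const c => Const c end.

Definition lift_subst L V W n (s : V -> term L W) :
    V + 'I_n -> term L (W + 'I_n) :=
  extend (fun x => term_subst (fun y => Var (inl y)) (s x))
         (fun i => Var (inr i)).

Fixpoint subst L V (phi : formula L V) :
    forall W : Type, (V -> term L W) -> formula L W :=
  match phi with
  | fEq t u => fun W s => fEq (term_subst s t) (term_subst s u)
  | fRel R t => fun W s => fRel R (fun i => term_subst s (t i))
  | fNot psi => fun W s => fNot (subst psi s)
  | fAnd J f => fun W s => fAnd (fun i => subst (f i) s)
  | fOr J f => fun W s => fOr (fun i => subst (f i) s)
  | fAll n psi => fun W s => fAll n (subst psi (@lift_subst L _ W n s))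
  | fEx n psi => fun W s => fEx n (subst psi (@lift_subst L _ W n s))
  end.

(* [inst phi t] is phi(t/v), where v is the tuple of variables [inr i]. *)
Definition inst L V n (phi : formula L (V + 'I_n)) (t : 'I_n -> term L V) :
    formula L V :=
  subst phi (extend Var t).

(* The sequent calculus regards formulae as built from negation, conjunction and
   universal quantification only; [expand] unfolds the other two connectives,
   seen as abbreviations. *)
Fixpoint primitive L V (phi : formula L V) : Prop :=
  match phi with
  | fEq _ _ => True
  | fRel _ _ => True
  | fNot psi => primitive psi
  | fAnd J f => forall i, primitive (f i)
  | fOr J f => False
  | fAll n psi => primitive psi
  | fEx n psi => False
  end.

Fixpoint expand L V (phi : formula L V) : formula L V :=
  match phi with
  | fEq s t => fEq s t
  | fRel R t => fRel R t
  | fNot psi => fNot (expand psi)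
  | fAnd J f => fAnd (fun i => expand (f i))
  | fOr J f => fNot (fAnd (fun i => fNot (expand (f i))))
  | fAll n psi => fAll n (expand psi)
  | fEx n psi => fNot (fAll n (fNot (expand psi)))
  end.

Section BooleanValuedModels.
Context {d : Order.disp_t}.

Definition complete_lattice (B : ctbDistrLatticeType d) : Prop :=
  forall A : set B, supremums A !=set0 /\ infimums A !=set0.

Definition bsup (B : ctbDistrLatticeType d) (A : set B) : B :=
  supremum \bot%O A.
Definition binf (B : ctbDistrLatticeType d) (A : set B) : B :=
  infimum \top%O A.

Record bvmodel (L : signature) (B : ctbDistrLatticeType d) := BVModel {
  carrier :> Type;
  carrier_inhabited : inhabited carrier;
  beq : carrier -> carrier -> B;
  brel : forall R : relsym L, ('I_(arity R) -> carrier) -> B;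
  bconst : constsym L -> carrier;
  beq_refl : forall x, beq x x = \top%O;
  beq_sym : forall x y, beq x y = beq y x;
  beq_trans : forall x y z, (beq x y `&` beq y z <= beq x z)%O;
  brel_congr : forall R (x y : 'I_(arity R) -> carrier),
    ((\meet_(i < arity R) beq (x i) (y i)) `&` brel x <= brel y)%O
}.

Variables (L : signature) (B : ctbDistrLatticeType d) (M : bvmodel L B).

Definition term_value V (nu : V -> M) (t : term L V) : M :=
  match t with Var x => nu x | Const c => bconst M c end.

Fixpoint value V (phi : formula L V) : (V -> M) -> B :=
  match phi with
  | fEq s t => fun nu => beq (term_value nu s) (term_value nu t)
  | fRel R t => fun nu => brel (fun i => term_value nu (t i))
  | fNot psi => fun nu => (~` value psi nu)%O
  | fAnd J f => fun nu => binf (range (fun i => value (f i) nu))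
  | fOr J f => fun nu => bsup (range (fun i => value (f i) nu))
  | fAll n psi => fun nu =>
      binf (range (fun tau : 'I_n -> M => value psi (extend nu tau)))
  | fEx n psi => fun nu =>
      bsup (range (fun tau : 'I_n -> M => value psi (extend nu tau)))
  end.

Definition antichain (A : set B) : Prop :=
  forall a b, A a -> A b -> a <> b -> (a `&` b = \bot)%O.

Definition mixing : Prop :=
  forall (A : set B) (tau : B -> M), antichain A ->
    exists x : M, forall a, A a -> (a <= beq x (tau a))%O.

Definition satisfies V (Gamma Delta : set (formula L V)) : Prop :=
  forall nu : V -> M,
    (binf [set value phi nu | phi in Gamma] <=
     bsup [set value phi nu | phi in Delta])%O.

End BooleanValuedModels.

Definition models_BVM L V (Gamma Delta : set (formula L V)) : Prop :=
  forall (d : Order.disp_t) (B : ctbDistrLatticeType d) (M : bvmodel L B),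
    complete_lattice B -> satisfies M Gamma Delta.

Definition models_Sh L V (Gamma Delta : set (formula L V)) : Prop :=
  forall (d : Order.disp_t) (B : ctbDistrLatticeType d) (M : bvmodel L B),
    complete_lattice B -> mixing M -> satisfies M Gamma Delta.

Section SequentCalculus.
Variables (L : signature) (V : Type).
Implicit Types (Gamma Delta : set (formula L V)) (phi : formula L V).

Definition sequent : Type := set (formula L V) * set (formula L V).

(* [rule P s]: the sequent [s] is an axiom, or follows by one rule from
   sequents satisfying [P].  The calculus has a reflexivity axiom [v = v],
   without which it would be incomplete: the other rules remain sound when
   equality is interpreted by the empty relation.
   The tuple [w] of [r_forallR] consists of pairwise distinct variables. *)
Inductive rule (P : sequent -> Prop) : sequent -> Prop :=
| r_axiom Gamma Delta phi :
    rule P (Gamma `|` [set phi], [set phi] `|` Delta)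
| r_cut Gamma Gamma' Delta Delta' phi :
    P (Gamma `|` [set phi], Delta) ->
    P (Gamma', [set phi] `|` Delta') ->
    rule P (Gamma `|` Gamma', Delta `|` Delta')
| r_subst Gamma Delta (w : V -> V) :
    P (Gamma, Delta) ->
    rule P ([set subst phi (fun v => Var (w v)) | phi in Gamma],
            [set subst phi (fun v => Var (w v)) | phi in Delta])
| r_weak Gamma Gamma' Delta Delta' :
    P (Gamma, Delta) ->
    rule P (Gamma `|` Gamma', Delta `|` Delta')
| r_notL Gamma Delta phi :
    P (Gamma, [set phi] `|` Delta) ->
    rule P (Gamma `|` [set fNot phi], Delta)
| r_notR Gamma Delta phi :
    P (Gamma `|` [set phi], Delta) ->
    rule P (Gamma, [set fNot phi] `|` Delta)
| r_andL Gamma Delta (J : index) (f : J -> formula L V) :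
    P (Gamma `|` range f, Delta) ->
    rule P (Gamma `|` [set fAnd f], Delta)
| r_andR Gamma Delta (J : index) (f : J -> formula L V) :
    (forall i, P (Gamma, [set f i] `|` Delta)) ->
    rule P (Gamma, [set fAnd f] `|` Delta)
| r_forallL Gamma Delta n (phi : formula L (V + 'I_n))
    (t : 'I_n -> term L V) :
    P (Gamma `|` [set inst phi t], Delta) ->
    rule P (Gamma `|` [set fAll n phi], Delta)
| r_forallR Gamma Delta n (phi : formula L (V + 'I_n)) (w : 'I_n -> V) :
    injective w ->
    (forall i psi, (Gamma `|` Delta) psi -> ~ free_var psi (w i)) ->
    (forall i, ~ free_var phi (inl (w i))) ->
    P (Gamma, [set inst phi (fun i => Var (w i))] `|` Delta) ->
    rule P (Gamma, [set fAll n phi] `|` Delta)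
| r_eq_refl (v : V) :
    rule P (set0, [set fEq (Var v) (Var v)])
| r_eq1 (v v' : V) :
    rule P ([set fEq (Var v) (Var v')], [set fEq (Var v') (Var v)])
| r_eq2 n (phi : formula L (V + 'I_n)) (u t : 'I_n -> term L V) :
    rule P (range (fun i => fEq (u i) (t i)) `|` [set inst phi t],
            [set inst phi u]).

Definition primitive_sequent (s : sequent) : Prop :=
  forall phi, (s.1 `|` s.2) phi -> Linfomega phi /\ primitive phi.

(* Up to isomorphism, the ordinals [alpha <= beta] are the elements of a
   well-ordered type with greatest element [beta]. *)
Definition proof_sequence (W : eqType) (le : rel W) (s : W -> sequent) :=
  forall a, primitive_sequent (s a) /\
            rule (fun q => exists2 b, le b a && (b != a) & s b = q) (s a).

Definition derivation (q : sequent) : Prop :=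
  exists (W : eqType) (le : rel W) (beta : W) (s : W -> sequent),
    [/\ well_order le, forall a, le a beta,
        proof_sequence le s & s beta = q].

Definition provable Gamma Delta : Prop :=
  derivation ([set expand phi | phi in Gamma],
              [set expand phi | phi in Delta]).

End SequentCalculus.

(* Main.v *)
(* Soundness is an induction along the derivation.

   Every [B]-valued model embeds, with the same values for all formulae, in the
   model of its [B]-valued singletons, which has the mixing property; hence
   validity in mixing models is validity in all models.

   For completeness, rename the variables so that infinitely many do not occur
   in [T, S].  Finite sets [Gamma] of formulae, with [Gamma] absurd when
   [T, Gamma |- S], generate a complete Boolean algebra of sets [A] equal to
   their double orthogonal, where [Gamma] and [Gamma'] are orthogonal when their
   union is absurd.  The terms form a model in which the value of [phi] is the
   set of all [Gamma] with [T, Gamma |- phi, S].  Fresh variables are always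
   available because each [Gamma] is finite, so quantifiers take the right
   value.  The members of [T] have value 1 and those of [S] value 0; validity of
   the sequent thus forces 0 = 1, that is, [T |- S]. *)
From HB Require Import structures.
Require Import Defs.
From mathcomp Require Import all_boot all_order.
From mathcomp Require Import all_classical wochoice.

Set Implicit Arguments.
Unset Strict Implicit.
Unset Printing Implicit Defensive.

Import Order.Theory.

Local Open Scope classical_set_scope.

(** * Substitution and free variables *)

Section Substitution.
Context {L : signature}.

Lemma term_subst_id V (t : term L V) : term_subst Var t = t.
Proof. by case: t. Qed.

Lemma term_subst_comp V W X (s : V -> term L W) (s' : W -> term L X) t :
  term_subst s' (term_subst s t) = term_subst (fun x => term_subst s' (s x)) t.
Proof. by case: t. Qed.

Lemma lift_subst_id V n : @lift_subst L V V n Var = Var.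
Proof. by apply: funext => -[]. Qed.

Lemma lift_subst_comp V W X n (s : V -> term L W) (s' : W -> term L X) :
  (fun x => term_subst (lift_subst (n := n) s') (lift_subst s x)) =
  lift_subst (fun x => term_subst s' (s x)).
Proof. by apply: funext => -[x|i] //=; case: (s x). Qed.

Lemma subst_id V (phi : formula L V) : subst phi Var = phi.
Proof.
elim: phi =>
  {V} [V s t|V R t|V phi IH|V J f IH|V J f IH|V n phi IH|V n phi IH] /=.
- by rewrite !term_subst_id.
- by congr fRel; apply: funext => i; rewrite term_subst_id.
- by rewrite IH.
- by congr fAnd; apply: funext => i; rewrite IH.
- by congr fOr; apply: funext => i; rewrite IH.
- by rewrite lift_subst_id IH.
- by rewrite lift_subst_id IH.
Qed.

Lemma subst_comp V (phi : formula L V) W X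
    (s : V -> term L W) (s' : W -> term L X) :
  subst (subst phi s) s' = subst phi (fun x => term_subst s' (s x)).
Proof.
elim: phi W X s s' =>
  {V} [V t u|V R t|V phi IH|V J f IH|V J f IH|V n phi IH|V n phi IH]
  W X s s' /=.
- by rewrite !term_subst_comp.
- by congr fRel; apply: funext => i; rewrite term_subst_comp.
- by rewrite IH.
- by congr fAnd; apply: funext => i; rewrite IH.
- by congr fOr; apply: funext => i; rewrite IH.
- by rewrite IH lift_subst_comp.
- by rewrite IH lift_subst_comp.
Qed.

(** Instantiation undoes the weakening by [inl] that lifting performs. The quantifier case of
    [value_truth] rests on this identity. *)
Lemma inst_lift_subst V W n (psi : formula L (V + 'I_n)) (s : V -> term L W)
    (t : 'I_n -> term L W) :
  inst (subst psi (lift_subst s)) t = subst psi (extend s t).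
Proof.
rewrite /inst subst_comp; congr subst; apply: funext => -[x|i] //=.
by case: (s x).
Qed.

Lemma free_var_subst V (phi : formula L V) W (s : V -> term L W) :
  free_var (subst phi s) `<=` \bigcup_(x in free_var phi) term_var (s x).
Proof.
have subT V' W' (r : V' -> term L W') t y :
    term_var (term_subst r t) y -> exists2 x, term_var t x & term_var (r x) y.
  by case: t => //= x rxy; exists x.
(* [lift_subst] fixes the bound variables [inr i], so a variable [inl y] can only come from the term
   substituted for some [inl x']. *)
have subL V' W' n (r : V' -> term L W') x y :
    term_var (lift_subst (n := n) r x) (inl y) ->
    exists2 x', x = inl x' & term_var (r x') y.
  case: x => [x|i] //= xy; exists x => //; move: xy.
  by case: (r x) => //= z [->].
elim: phi W s =>
  {V} [V t u|V R t|V phi IH|V J f IH|V J f IH|V n phi IH|V n phi IH]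
  W s y /=.
- by move=> [ty|ty]; have [x tx xy] := subT _ _ _ _ _ ty; exists x => //;
    [left|right].
- by move=> [i _ ty]; have [x tx xy] := subT _ _ _ _ _ ty; exists x => //;
    exists i.
- exact: IH.
- by move=> [i _ ty]; have [x fx xy] := IH _ _ _ _ ty; exists x => //; exists i.
- by move=> [i _ ty]; have [x fx xy] := IH _ _ _ _ ty; exists x => //; exists i.
- move=> ty; have [x fx sy] := IH _ _ _ ty.
  have [x' xE xy] := subL _ _ _ _ _ _ sy.
  by exists x' => //=; rewrite -xE.
- move=> ty; have [x fx sy] := IH _ _ _ ty.
  have [x' xE xy] := subL _ _ _ _ _ _ sy.
  by exists x' => //=; rewrite -xE.
Qed.

Lemma finite_term_var V (t : term L V) : finite_set (term_var t).
Proof. by case: t => [x|c] /=; [exact: finite_set1|exact: finite_set0]. Qed.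

Lemma finite_free_var V (phi : formula L V) :
  Linfomega phi -> finite_set (free_var phi).
Proof.
elim: phi =>
  {V} [V t u|V R t|V phi IH|V J f IH|V J f IH|V n phi IH|V n phi IH] //=.
- by rewrite finite_setU; split; exact: finite_term_var.
- by move=> _; apply: bigcup_finite => // i _; exact: finite_term_var.
- by case.
- by case.
- move=> /IH finphi; apply: (finite_preimage (f := inl)) finphi.
  by move=> x y _ _ [].
- move=> /IH finphi; apply: (finite_preimage (f := inl)) finphi.
  by move=> x y _ _ [].
Qed.

(** A term contains at most one variable, so the finitely many free variables of a family give rise
    to finitely many. *)
Lemma Linfomega_subst V (phi : formula L V) W (s : V -> term L W) :
  Linfomega phi -> Linfomega (subst phi s).
Proof.
have finJ J V' W' (f : J -> formula L V') (r : V' -> term L W') :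
    finite_set (\bigcup_i free_var (f i)) ->
    finite_set (\bigcup_i free_var (subst (f i) r)).
  move=> finf; apply: (@sub_finite_set _ _
    (\bigcup_(x in \bigcup_i free_var (f i)) term_var (r x))).
    move=> y [i _ ty]; have [x fx xy] := free_var_subst ty; exists x => //.
    by exists i.
  by apply: bigcup_finite => // x _; exact: finite_term_var.
elim: phi W s =>
  {V} [V t u|V R t|V phi IH|V J f IH|V J f IH|V n phi IH|V n phi IH]
  W s //=.
- exact: IH.
- by move=> [inff finf]; split; [move=> i; exact: IH|exact: finJ].
- by move=> [inff finf]; split; [move=> i; exact: IH|exact: finJ].
- exact: IH.
- exact: IH.
Qed.

Lemma primitive_subst V (phi : formula L V) W (s : V -> term L W) :
  primitive phi -> primitive (subst phi s).
Proof.
elim: phi W s =>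
  {V} [V t u|V R t|V phi IH|V J f IH|V J f IH|V n phi IH|V n phi IH]
  W s //=; do ?exact: IH.
by move=> primf i; exact: IH.
Qed.

Lemma primitive_expand V (phi : formula L V) : primitive (expand phi).
Proof. by elim: phi. Qed.

Lemma free_var_expand V (phi : formula L V) :
  free_var (expand phi) = free_var phi.
Proof.
elim: phi =>
  {V} [V t u|V R t|V phi IH|V J f IH|V J f IH|V n phi IH|V n phi IH] //=.
- by apply: eq_bigcupr => i _; rewrite IH.
- by apply: eq_bigcupr => i _; rewrite IH.
- by rewrite IH.
- by rewrite IH.
Qed.

Lemma Linfomega_expand V (phi : formula L V) :
  Linfomega phi -> Linfomega (expand phi).
Proof.
have finJ J V' (f : J -> formula L V') :
    finite_set (\bigcup_i free_var (f i)) ->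
    finite_set (\bigcup_i free_var (expand (f i))).
  by rewrite (eq_bigcupr (fun i _ => free_var_expand (f i))).
elim: phi =>
  {V} [V t u|V R t|V phi IH|V J f IH|V J f IH|V n phi IH|V n phi IH] //=.
- by move=> [inff finf]; split; [move=> i; exact: IH|exact: finJ].
- by move=> [inff finf]; split; [move=> i; exact: IH|exact: finJ].
Qed.

End Substitution.

(** * Soundness *)

Lemma eq_binf_range d (B : ctbDistrLatticeType d) J (f g : J -> B) :
  f =1 g -> binf (range f) = binf (range g).
Proof. by move/funext ->. Qed.

Lemma eq_bsup_range d (B : ctbDistrLatticeType d) J (f g : J -> B) :
  f =1 g -> bsup (range f) = bsup (range g).
Proof. by move/funext ->. Qed.

(** * Suprema, infima and complements in a complete Boolean algebra *)

Section CompleteBooleanAlgebra.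
Local Open Scope order_scope.
Context {d : Order.disp_t} {B : ctbDistrLatticeType d}.
Hypothesis complB : complete_lattice B.
Implicit Types (A : set B) (a b x : B).

Lemma bsup_ub A x : A x -> x <= bsup A.
Proof.
(* [supremum] returns its default on the empty set and otherwise a chosen element of [supremums A],
   which completeness makes nonempty. *)
rewrite /bsup /supremum; case: ifP => [/eqP -> //|_].
have [ub _] : supremums A (xget \bot (supremums A)).
  by apply: xgetPex; case: (complB A).
exact: ub.
Qed.

Lemma binf_lb A x : A x -> binf A <= x.
Proof.
rewrite /binf /infimum; case: ifP => [/eqP -> //|_].
have [lb _] : infimums A (xget \top (infimums A)).
  by apply: xgetPex; case: (complB A).
exact: lb.
Qed.

Lemma bsup_least A b : (forall x, A x -> x <= b) -> bsup A <= b.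
Proof.
rewrite /bsup /supremum; case: ifP => [_ _|_]; first exact: le0x.
have [_ least] : supremums A (xget \bot (supremums A)).
  by apply: xgetPex; case: (complB A).
exact: least.
Qed.

Lemma binf_greatest A b : (forall x, A x -> b <= x) -> b <= binf A.
Proof.
rewrite /binf /infimum; case: ifP => [_ _|_]; first exact: lex1.
have [_ greatest] : infimums A (xget \top (infimums A)).
  by apply: xgetPex; case: (complB A).
exact: greatest.
Qed.

(** Residuation: the join of [b] with the complement of [a] is the implication from [a] to [b].
    Infinite distributivity ([meet_bsup_le]) follows from it. *)
Lemma leCRL a b x : (a `&` x <= b) = (x <= ~` a `|` b).
Proof. by rewrite -leBLR diffE complK meetC. Qed.

Lemma le_compl a x : (a <= ~` x) = (a `&` x <= \bot).
Proof. by rewrite -disj_leC lex0. Qed.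

Lemma le_nocompl a x : (a <= x) = (a `&` ~` x <= \bot).
Proof. by rewrite -le_compl complK. Qed.

Lemma le_bot a x : a <= x -> a `&` x <= \bot -> a <= \bot.
Proof. by move=> ax; apply: le_trans; rewrite lexI lexx. Qed.

Lemma meet_bsup_le A a b :
  (forall x, A x -> a `&` x <= b) -> a `&` bsup A <= b.
Proof.
by move=> leb; rewrite leCRL; apply: bsup_least => x Ax; rewrite -leCRL leb.
Qed.

Lemma bsup_compl J (f : J -> B) :
  bsup (range f) = ~` binf (range (fun i => ~` f i)).
Proof.
apply: le_anti; apply/andP; split.
  apply: bsup_least => _ [i _ <-]; rewrite -[f i]complK leC.
  by apply: binf_lb; exists i.
rewrite -[leRHS]complK leC; apply: binf_greatest => _ [i _ <-].
by rewrite leC; apply: bsup_ub; exists i.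
Qed.

End CompleteBooleanAlgebra.

(** * Values under substitution, expansion and change of assignment *)

Section Values.
Local Open Scope order_scope.
Context {L : signature} {d : Order.disp_t} {B : ctbDistrLatticeType d}.
Variable M : bvmodel L B.

Lemma term_value_subst V W (s : V -> term L W) (nu : W -> M) t :
  term_value nu (term_subst s t) = term_value (fun x => term_value nu (s x)) t.
Proof. by case: t. Qed.

Lemma value_subst V (phi : formula L V) W (s : V -> term L W) (nu : W -> M) :
  value (subst phi s) nu = value phi (fun x => term_value nu (s x)).
Proof.
have extL V' W' n (r : V' -> term L W') (mu : W' -> M) (tau : 'I_n -> M) :
    (fun x => term_value (extend mu tau) (lift_subst r x)) =
    extend (fun x => term_value mu (r x)) tau.
  by apply: funext => -[x|i] //=; case: (r x).
elim: phi W s nu =>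
  {V} [V t u|V R t|V phi IH|V J f IH|V J f IH|V n phi IH|V n phi IH]
  W s nu /=.
- by rewrite !term_value_subst.
- by congr brel; apply: funext => i; rewrite term_value_subst.
- by rewrite IH.
- by apply: eq_binf_range => i; rewrite IH.
- by apply: eq_bsup_range => i; rewrite IH.
- by apply: eq_binf_range => tau; rewrite IH extL.
- by apply: eq_bsup_range => tau; rewrite IH extL.
Qed.

Lemma value_inst V n (phi : formula L (V + 'I_n)) (t : 'I_n -> term L V)
    (nu : V -> M) :
  value (inst phi t) nu = value phi (extend nu (fun i => term_value nu (t i))).
Proof. by rewrite value_subst; congr value; apply: funext => -[]. Qed.

Lemma eq_value V (phi : formula L V) (nu nu' : V -> M) :
  (forall x, free_var phi x -> nu x = nu' x) -> value phi nu = value phi nu'.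
Proof.
have eqt V' (mu mu' : V' -> M) (t : term L V') :
    (forall x, term_var t x -> mu x = mu' x) ->
    term_value mu t = term_value mu' t.
  by case: t => //= x /(_ x erefl).
elim: phi nu nu' =>
  {V} [V t u|V R t|V phi IH|V J f IH|V J f IH|V n phi IH|V n phi IH]
  nu nu' /= eqnu.
- by congr beq; apply: eqt => x tx; apply: eqnu; [left|right].
- by congr brel; apply: funext => i; apply: eqt => x tx; apply: eqnu; exists i.
- by rewrite (IH nu nu').
- apply: eq_binf_range => i; apply: IH => x fx.
  by apply: eqnu; exists i.
- apply: eq_bsup_range => i; apply: IH => x fx.
  by apply: eqnu; exists i.
- apply: eq_binf_range => tau; apply: IH => -[x|i] //= fx.
  exact: eqnu.
- apply: eq_bsup_range => tau; apply: IH => -[x|i] //= fx.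
  exact: eqnu.
Qed.

Hypothesis complB : complete_lattice B.

Lemma value_expand V (phi : formula L V) (nu : V -> M) :
  value (expand phi) nu = value phi nu.
Proof.
elim: phi nu =>
  {V} [V t u|V R t|V phi IH|V J f IH|V J f IH|V n phi IH|V n phi IH]
  nu //=.
- by rewrite IH.
- by apply: eq_binf_range => i; rewrite IH.
- rewrite (bsup_compl complB).
  by congr (~` _)%O; apply: eq_binf_range => i; rewrite IH.
- by apply: eq_binf_range => tau; rewrite IH.
- rewrite (bsup_compl complB).
  by congr (~` _)%O; apply: eq_binf_range => tau; rewrite IH.
Qed.

Lemma term_value_congr V (t : term L V) (nu nu' : V -> M) (a : B) :
  (forall x, a <= beq (nu x) (nu' x)) ->
  a <= beq (term_value nu t) (term_value nu' t).
Proof. by move=> anu; case: t => //= c; rewrite beq_refl lex1. Qed.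

Lemma beq_congr (a : B) (x x' y y' : M) :
  a <= beq x x' -> a <= beq y y' -> a `&` beq x y <= beq x' y'.
Proof.
move=> axx ayy; apply: le_trans (beq_trans x' y y'); rewrite lexI.
rewrite (le_trans _ ayy) ?leIl // andbT.
apply: le_trans (beq_trans x' x y); rewrite lexI leIr andbT.
by rewrite (beq_sym x') (le_trans _ axx) ?leIl.
Qed.

(** This gives the soundness of Equality 2. It also serves the mixing completion, where a singleton
    is replaced by an element of [M] equal to it below some condition. *)
Lemma value_congr V (phi : formula L V) (nu nu' : V -> M) (a : B) :
  (forall x, a <= beq (nu x) (nu' x)) -> a `&` value phi nu <= value phi nu'.
Proof.
elim: phi nu nu' =>
  {V} [V t u|V R t|V phi IH|V J f IH|V J f IH|V n phi IH|V n phi IH]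
  nu nu' anu /=.
- by apply: beq_congr; exact: term_value_congr.
- apply: le_trans (brel_congr _ _); rewrite leI2 //.
  by apply/meetsP => i _; exact: term_value_congr.
(* The induction hypothesis is used with the two assignments exchanged, in contrapositive form. *)
- rewrite le_compl -meetA (meetC (~` _)) meetA -le_compl complK.
  by apply: IH => x; rewrite beq_sym.
- apply: (binf_greatest complB) => _ [i _ <-].
  apply: le_trans (IH i _ _ anu); rewrite leI2 //.
  by apply: (binf_lb complB); exists i.
- apply: (meet_bsup_le complB) => _ [i _ <-].
  apply: le_trans (IH i _ _ anu) _.
  by apply: (bsup_ub complB); exists i.
- apply: (binf_greatest complB) => _ [tau _ <-].
  apply: le_trans (IH (extend nu tau) _ _); last first.
    by move=> [x|i] //=; rewrite beq_refl lex1.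
  by rewrite leI2 //; apply: (binf_lb complB); exists tau.
- apply: (meet_bsup_le complB) => _ [tau _ <-].
  apply: le_trans (IH _ (extend nu' tau) _) _.
    by move=> [x|i] //=; rewrite beq_refl lex1.
  by apply: (bsup_ub complB); exists tau.
Qed.

End Values.

(** * Validity of the rules and of derivations *)

Section Soundness.
Local Open Scope order_scope.
Context {L : signature} {d : Order.disp_t} {B : ctbDistrLatticeType d}.
Variable M : bvmodel L B.
Hypothesis complB : complete_lattice B.
Context {V : Type}.
Implicit Types (nu : V -> M) (a : B) (q : sequent L V).

(** Read [a] as a condition that forces every formula on the left and is incompatible with every
    formula on the right. Rules can then be checked without infima and suprema over whole
    sequents. *)
Definition refutes nu a q :=
  (forall phi, q.1 phi -> a <= value phi nu) /\
  (forall psi, q.2 psi -> a `&` value psi nu <= \bot).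

Definition valid q := forall nu a, refutes nu a q -> a <= \bot.

Lemma satisfiesP Gamma Delta : satisfies M Gamma Delta <-> valid (Gamma, Delta).
Proof.
split=> [sat nu a [aG aD]|val nu].
  have aS : a <= bsup [set value phi nu | phi in Delta].
    apply: le_trans (sat nu).
    by apply: (binf_greatest complB) => _ [phi Gphi <-]; exact: aG.
  apply: (le_bot aS).
  by apply: (meet_bsup_le complB) => _ [psi Dpsi <-]; exact: aD Dpsi.
(* Validity is applied to the largest refuting condition: the infimum of the left side met with the
   complement of the supremum of the right side. *)
rewrite le_nocompl; apply: (val nu); split=> [phi Gphi|psi Dpsi] /=.
  by rewrite leIxl //; apply: (binf_lb complB); exists phi.
rewrite -le_compl leIxr // leC.
by apply: (bsup_ub complB); exists psi.
Qed.

Lemma refutesS nu a a' q q' : a' <= a -> q'.1 `<=` q.1 -> q'.2 `<=` q.2 ->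
  refutes nu a q -> refutes nu a' q'.
Proof.
move=> le_a q1 q2 [aG aD]; split=> [phi /q1/aG|psi /q2/aD].
  exact: le_trans.
by apply: le_trans; rewrite leI2.
Qed.

(** Where a rule has premises, a condition [a] refuting the conclusion yields one refuting a
    premise: [a] itself, or its meet with the value, or with the complement of the value, of a
    formula of that premise. *)
Lemma rule_valid (P : sequent L V -> Prop) q :
  (forall q', P q' -> valid q') -> rule P q -> valid q.
Proof.
move=> validP; case.
- move=> Gamma Delta phi nu a [aG aD].
  by apply: (le_bot (aG phi _) (aD phi _)); [right|left].
- move=> Gamma Gamma' Delta Delta' phi /validP v1 /validP v2 nu a aGD.
  apply: (v2 nu); split=> [psi Gpsi|psi [->|Dpsi]].
  + by apply: aGD.1; right.
  + apply: (v1 nu); split=> [chi [Gchi|->]|chi Dchi] /=.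
    * by rewrite leIxl //; apply: aGD.1; left.
    * exact: leIr.
    * by rewrite meetAC leIxl //; apply: aGD.2; left.
  + by apply: aGD.2; right.
- move=> Gamma Delta w /validP v nu a [aG aD].
  apply: (v (fun x => nu (w x))); split=> [phi Gphi|psi Dpsi].
  + by rewrite -(value_subst _ (fun x => Var (w x)) nu); apply: aG; exists phi.
  + by rewrite -(value_subst _ (fun x => Var (w x)) nu); apply: aD; exists psi.
- move=> Gamma Gamma' Delta Delta' /validP v nu a aGD.
  by apply: (v nu); apply: refutesS aGD => // phi; left.
- move=> Gamma Delta phi /validP v nu a aGD.
  apply: (v nu); split=> [psi Gpsi|psi [->|Dpsi]].
  + by apply: aGD.1; left.
  + by rewrite -le_compl; apply: (aGD.1 (fNot phi)); right.
  + exact: aGD.2.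
- move=> Gamma Delta phi /validP v nu a aGD.
  have anot : a <= value phi nu.
    by rewrite le_nocompl; apply: (aGD.2 (fNot phi)); left.
  apply: (v nu); split=> [psi [Gpsi|->//]|psi Dpsi]; first exact: aGD.1.
  by apply: aGD.2; right.
- move=> Gamma Delta J f /validP v nu a aGD.
  apply: (v nu); split=> [psi [Gpsi|[i _ <-]]|psi Dpsi].
  + by apply: aGD.1; left.
  + apply: le_trans (aGD.1 (fAnd f) _) _; first by right.
    by apply: (binf_lb complB); exists i.
  + exact: aGD.2.
- move=> Gamma Delta J f Pf nu a aGD.
  suff aand : a <= value (fAnd f) nu.
    by apply: (le_bot aand); apply: aGD.2; left.
  apply: (binf_greatest complB) => _ [i _ <-]; rewrite le_nocompl.
  apply: (validP _ (Pf i) nu); split=> [psi Gpsi|psi [->|Dpsi]] /=.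
  + by rewrite leIxl //; exact: aGD.1.
  + by rewrite -le_compl leIr.
  + by rewrite meetAC leIxl //; apply: aGD.2; right.
- move=> Gamma Delta n phi t /validP v nu a aGD.
  apply: (v nu); split=> [psi [Gpsi|->]|psi Dpsi].
  + by apply: aGD.1; left.
  + apply: le_trans (aGD.1 (fAll n phi) _) _; first by right.
    by rewrite value_inst; apply: (binf_lb complB); eexists.
  + exact: aGD.2.
- move=> Gamma Delta n phi w injw freshGD freshphi /validP v nu a aGD.
  suff aall : a <= value (fAll n phi) nu.
    by apply: (le_bot aall); apply: aGD.2; left.
  apply: (binf_greatest complB) => _ [tau _ <-]; rewrite le_nocompl.
  (* [nu'] sends the fresh variables [w i] to the given [tau i] and agrees with [nu] elsewhere, so
     it changes no value of a side formula. *)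
  pose nu' x := if pselect (exists i, w i = x) is left ex
                then tau (projT1 (cid ex)) else nu x.
  have nu'w i : nu' (w i) = tau i.
    rewrite /nu'; case: pselect => [ex|]; last by case; exists i.
    by case: (cid ex) => j /= /injw ->.
  have nu'E x : (forall i, w i <> x) -> nu' x = nu x.
    by rewrite /nu'; case: pselect => // -[i wi] /(_ i).
  have valE psi : (Gamma `|` Delta) psi -> value psi nu' = value psi nu.
    move=> GDpsi; apply: eq_value => x psix; apply: nu'E => i wix.
    by apply: (freshGD i psi GDpsi); rewrite wix.
  have valphi :
      value phi (extend nu tau) = value (inst phi (fun i => Var (w i))) nu'.
    rewrite value_inst; apply: eq_value => -[x|i] //= phix.
    by rewrite nu'E // => i wix; apply: (freshphi i); rewrite wix.
  apply: (v nu'); split=> [psi Gpsi|psi [->|Dpsi]] /=.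
  + by rewrite leIxl // valE; [exact: aGD.1|left].
  + by rewrite -le_compl -valphi leIr.
  + by rewrite meetAC leIxl // valE; [apply: aGD.2|]; right.
- move=> v nu a [_ /(_ (fEq (Var v) (Var v)) erefl)] /=.
  by rewrite beq_refl meetx1.
- move=> v v' nu a [aG aD]; apply: le_bot (aD _ erefl) => /=.
  by rewrite beq_sym; exact: aG (fEq (Var v) (Var v')) erefl.
- move=> n phi u t nu a [aG aD]; apply: le_bot (aD _ erefl).
  have at_ : a <= value (inst phi t) nu by apply: aG; right.
  rewrite -[a]meetxx; apply: le_trans (leI2 (lexx a) at_) _.
  rewrite !value_inst; apply: (value_congr complB) => -[x|i] /=.
    by rewrite beq_refl lex1.
  by rewrite beq_sym; apply: (aG (fEq (u i) (t i))); left; exists i.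
Qed.

Lemma derivation_valid q : derivation q -> valid q.
Proof.
move=> [W [le [b [s [wo _ pf <-]]]]]; apply: contrapT => inv.
(* [a] is the least position whose sequent is invalid; its premises sit earlier and so are valid. *)
have [a [[/asboolP ina mina] _]] :
    exists! w, minimum_of le (fun w => `[< ~ valid (s w) >]) w.
  by apply: wo; exists b; exact/asboolP.
apply: ina; apply: rule_valid (pf a).2 => q' [c /andP[le_ca ca] <-].
apply: contrapT => inc.
(* [well_order] only speaks of unique minima; antisymmetry is what excludes a distinct invalid [c]
   below [a]. *)
have anti : {in predT &, antisymmetric le}.
  exact: (@wo_chain_antisymmetric W le predT (fun A _ => wo A)).
have: c = a by apply: anti => //; rewrite le_ca mina //; apply/asboolP.
by move/eqP; rewrite (negbTE ca).
Qed.

End Soundness.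

Lemma value_expand_image L V d (B : ctbDistrLatticeType d) (M : bvmodel L B)
    (nu : V -> M) (A : set (formula L V)) : complete_lattice B ->
  [set value phi nu | phi in [set expand phi | phi in A]] =
  [set value phi nu | phi in A].
Proof.
move=> complB; rewrite image_comp; apply: eq_imagel => phi _ /=.
exact: value_expand.
Qed.

Lemma provable_models_BVM L V (T S : set (formula L V)) :
  provable T S -> models_BVM T S.
Proof.
move=> der d B M complB.
have /(satisfiesP M complB) sat := derivation_valid (M := M) complB der.
by move=> nu; have := sat nu; rewrite !value_expand_image.
Qed.

(** * The mixing completion *)

Section Covers.
Local Open Scope order_scope.
Context {d : Order.disp_t} {B : ctbDistrLatticeType d}.
Hypothesis complB : complete_lattice B.

(** Existential elimination for a supremum: it suffices to treat the conditions [c] below [a] that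
    have settled on a witness [j]. *)
Lemma bsup_elim J (F : J -> B) a b : a <= bsup (range F) ->
  (forall c j, c <= a -> c <= F j -> c <= b) -> a <= b.
Proof.
move=> aF leb; rewrite -[a]meetxx; apply: le_trans (leI2 (lexx a) aF) _.
by apply: (meet_bsup_le complB) => _ [j _ <-]; apply: (leb _ j);
  [exact: leIl|exact: leIr].
Qed.

(** Witnesses are picked one coordinate at a time, shrinking the condition at each step. Finiteness
    of [n] is essential: for infinitely many coordinates this would be a distributive law that fails
    in general. *)
Lemma bsup_choice n J (F : 'I_n -> J -> B) a b :
  (forall i, bsup (range (F i)) = \top) ->
  (forall c (x : 'I_n -> J), c <= a -> (forall i, c <= F i (x i)) -> c <= b) ->
  a <= b.
Proof.
elim: n F a => [|n IH] F a topF leb.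
  have x : 'I_0 -> J by case.
  by apply: (leb a x) => // -[].
apply: (@bsup_elim _ (F ord0)) => [|c j ca cj]; first by rewrite topF lex1.
apply: (IH (fun i => F (lift ord0 i))) => // c' x c'c c'x.
apply: (leb c' (fun i => if unlift ord0 i is Some k then x k else j)).
  exact: le_trans ca.
by move=> i; case: unliftP => [k ->|->] //; exact: le_trans cj.
Qed.

End Covers.

(* The elements of the mixing completion are the "[B]-valued singletons" of the
   model: [f x] plays the role of the value of [f = x]. *)
Record bsingleton (L : signature) d (B : ctbDistrLatticeType d)
    (M : bvmodel L B) := BSingleton {
  bsg :> M -> B;
  bsg_unique : forall x y, (bsg x `&` bsg y <= beq x y)%O;
  bsg_congr : forall x y, (bsg x `&` beq x y <= bsg y)%O;
  bsg_total : bsup (range bsg) = \top%O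
}.

Section MixingCompletion.
Local Open Scope order_scope.
Context {L : signature} {d : Order.disp_t} {B : ctbDistrLatticeType d}.
Variable M : bvmodel L B.
Hypothesis complB : complete_lattice B.
Implicit Types (f g h : bsingleton M) (x y : M) (c : B).

Lemma bsg_beq f c x y : c <= f x -> c <= f y -> c <= beq x y.
Proof.
by move=> cx cy; apply: le_trans (bsg_unique f x y); rewrite lexI cx.
Qed.

Lemma bsg_subst f c x y : c <= f x -> c <= beq x y -> c <= f y.
Proof. by move=> cx cy; apply: le_trans (bsg_congr f x y); rewrite lexI cx. Qed.

(** The value of the assertion that some element of [M] equals both singletons; [srel_value] follows
    the same pattern. *)
Definition seq_value f g : B := bsup (range (fun x => f x `&` g x)).

Definition srel_value (R : relsym L) (f : 'I_(arity R) -> bsingleton M) : B :=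
  bsup (range (fun x : 'I_(arity R) -> M =>
    (\meet_(i < arity R) f i (x i)) `&` brel x)).

Lemma seq_intro f g c x : c <= f x -> c <= g x -> c <= seq_value f g.
Proof.
move=> cf cg; apply: (@le_trans _ _ (f x `&` g x)); first by rewrite lexI cf.
by apply: (bsup_ub complB); exists x.
Qed.

Lemma seq_elim f g c x : c <= seq_value f g -> c <= f x -> c <= g x.
Proof.
move=> cfg cf; apply: (bsup_elim complB cfg) => c' y c'c.
rewrite lexI => /andP[c'f c'g]; apply: (bsg_subst c'g).
exact: bsg_beq c'f (le_trans c'c cf).
Qed.

Lemma srel_intro R (f : 'I_(arity R) -> bsingleton M) c (x : 'I_(arity R) -> M) :
  (forall i, c <= f i (x i)) -> c <= brel x -> c <= srel_value f.
Proof.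
move=> cf cR.
apply: (@le_trans _ _ ((\meet_(i < arity R) f i (x i)) `&` brel x)).
  by rewrite lexI cR andbT; apply/meetsP.
by apply: (bsup_ub complB); exists x.
Qed.

Lemma srel_elim R (f : 'I_(arity R) -> bsingleton M) c (x : 'I_(arity R) -> M) :
  c <= srel_value f -> (forall i, c <= f i (x i)) -> c <= brel x.
Proof.
move=> cR cf; apply: (bsup_elim complB cR) => c' y c'c.
rewrite lexI => /andP[/meetsP c'f c'R].
apply: le_trans (brel_congr y x); rewrite lexI c'R andbT.
apply/meetsP => i _; apply: bsg_beq (c'f i isT) _.
exact: le_trans (cf i).
Qed.

Lemma beq_unique x y z : beq x y `&` beq x z <= beq y z.
Proof. by rewrite (beq_sym x y); exact: beq_trans. Qed.

Lemma beq_total x : bsup (range (beq x)) = \top.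
Proof.
apply: le_anti; rewrite lex1 /= -(beq_refl x).
by apply: (bsup_ub complB); exists x.
Qed.

Definition bsg_embed x : bsingleton M :=
  BSingleton (beq_unique x) (beq_trans x) (beq_total x).

Lemma bsingleton_inhabited : inhabited (bsingleton M).
Proof. by case: (carrier_inhabited M) => x; split; exact: bsg_embed. Qed.

Lemma seq_refl f : seq_value f f = \top.
Proof.
apply: le_anti; rewrite lex1 /=.
apply: (bsup_elim complB (F := f)) => [|c x _ cf]; first by rewrite bsg_total.
exact: (seq_intro cf cf).
Qed.

Lemma seq_sym f g : seq_value f g = seq_value g f.
Proof. by apply: eq_bsup_range => x; rewrite meetC. Qed.

Lemma seq_trans f g h : seq_value f g `&` seq_value g h <= seq_value f h.
Proof.
apply: (bsup_elim complB (F := f)) => [|c x]; first by rewrite bsg_total lex1.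
rewrite lexI => /andP[cfg cgh] cf; apply: (seq_intro cf).
exact: seq_elim cgh (seq_elim cfg cf).
Qed.

Lemma srel_congr R (f g : 'I_(arity R) -> bsingleton M) :
  (\meet_(i < arity R) seq_value (f i) (g i)) `&` srel_value f <= srel_value g.
Proof.
apply: (bsup_choice complB (F := fun i => f i)) => [i|c x].
  exact: bsg_total.
rewrite lexI => /andP[/meetsP cfg cR] cf; apply: (srel_intro (x := x)).
  by move=> i; apply: seq_elim (cfg i isT) (cf i).
exact: srel_elim cR cf.
Qed.

Definition mixing_completion : bvmodel L B :=
  BVModel bsingleton_inhabited (fun k : constsym L => bsg_embed (bconst M k))
    seq_refl seq_sym seq_trans srel_congr.

Lemma seq_embed x y : seq_value (bsg_embed x) (bsg_embed y) = beq x y.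
Proof.
apply: le_anti; apply/andP; split.
  by rewrite beq_sym; apply: (seq_elim (lexx _)); rewrite /= beq_refl lex1.
by apply: (@seq_intro _ _ _ y) => //=; rewrite beq_refl lex1.
Qed.

Lemma srel_embed R (x : 'I_(arity R) -> M) :
  srel_value (fun i => bsg_embed (x i)) = brel x.
Proof.
apply: le_anti; apply/andP; split.
  by apply: (srel_elim (x := x) (lexx _)) => i; rewrite /= beq_refl lex1.
by apply: (srel_intro (x := x)) => // i; rewrite /= beq_refl lex1.
Qed.

(** Only the universal quantifier has content: it ranges over more elements in the completion, yet
    each tuple of them agrees locally with tuples from [M]. Restricting to primitive formulae avoids
    the dual cases. *)
Lemma value_embed V (phi : formula L V) (nu : V -> M) : primitive phi ->
  value phi (fun v => bsg_embed (nu v) : mixing_completion) = value phi nu.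
Proof.
have termE V' (t : term L V') (mu : V' -> M) :
    term_value (fun v => bsg_embed (mu v) : mixing_completion) t =
    bsg_embed (term_value mu t) by case: t.
elim: phi nu =>
  {V} [V t u|V R t|V phi IH|V J f IH|V J f IH|V n phi IH|V n phi IH]
  nu //=.
- by rewrite !termE seq_embed.
- by rewrite (funext (fun i => termE _ (t i) nu)) srel_embed.
- by move=> ?; rewrite IH.
- by move=> primf; apply: eq_binf_range => i; rewrite IH.
- move=> prim; have extE (tau : 'I_n -> M) :
      (fun v => bsg_embed (extend nu tau v)) =
      extend (fun v => bsg_embed (nu v)) (fun i => bsg_embed (tau i)).
    by apply: funext => -[].
  apply: le_anti; apply/andP; split.
    apply: (binf_greatest complB) => _ [tau _ <-]; rewrite -IH // extE.
    by apply: (binf_lb complB); eexists.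
  apply: (binf_greatest complB) => _ [tau _ <-].
  (* Each [tau i] is total, so below a smaller condition [c] it can be identified with an element
     [x i] of [M]; [value_congr] then passes from [x] to [tau]. *)
  apply: (bsup_choice complB (F := fun i => tau i)) => [i|c x cphi ctau].
    exact: bsg_total.
  have cx :
      c <= value phi (fun v => bsg_embed (extend nu x v) : mixing_completion).
    rewrite IH //; apply: le_trans cphi _.
    by apply: (binf_lb complB); exists x.
  rewrite -[c]meetxx; apply: le_trans (leI2 (lexx c) cx) _.
  apply: (value_congr complB) => -[y|i] /=; first by rewrite seq_refl lex1.
  by rewrite seq_sym; apply: seq_intro (ctau i) _; rewrite /= beq_refl lex1.
Qed.

(** The singletons are glued: [f x] asserts that, on the part [a], the singleton [tau a] equals [x].
    Disjointness of the parts gives uniqueness, and maximality gives totality. *)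
Lemma maximal_antichain_mixing (A : set B) (tau : B -> bsingleton M) :
  antichain A -> bsup A = \top ->
  exists f, forall a, A a -> a <= seq_value f (tau a).
Proof.
move=> antiA topA.
pose f x := bsup [set a `&` tau a x | a in A].
have f_elim c x b : c <= f x ->
    (forall c' a, A a -> c' <= c -> c' <= a -> c' <= tau a x -> c' <= b) ->
    c <= b.
  move=> cf leb; rewrite -[c]meetxx; apply: le_trans (leI2 (lexx c) cf) _.
  apply: (meet_bsup_le complB) => _ [a Aa <-].
  by apply: (leb _ a) => //; rewrite ?leIl // leIxr // ?leIl ?leIr.
have f_intro c x a : A a -> c <= a -> c <= tau a x -> c <= f x.
  move=> Aa ca cx; apply: (@le_trans _ _ (a `&` tau a x)).
    by rewrite lexI ca.
  by apply: (bsup_ub complB); exists a.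
have f_unique x y : f x `&` f y <= beq x y.
  apply: (f_elim _ x); first exact: leIl.
  move=> c a Aa; rewrite lexI => /andP[_ cy] ca cx.
  apply: (f_elim _ y) cy _ => c' a' Aa' c'c c'a' c'y.
  have [aa'|aa'] := pselect (a = a').
    by apply: (bsg_beq (f := tau a)); [exact: le_trans cx|rewrite aa'].
  apply: (@le_trans _ _ (a `&` a')); first by rewrite lexI c'a' (le_trans c'c).
  by rewrite antiA // le0x.
have f_congr x y : f x `&` beq x y <= f y.
  apply: (f_elim _ x); first exact: leIl.
  move=> c a Aa; rewrite lexI => /andP[_ cxy] ca cx.
  by apply: (f_intro _ _ a) => //; exact: bsg_subst cx cxy.
have f_total : bsup (range f) = \top.
  apply: le_anti; rewrite lex1 /= -topA; apply: (bsup_least complB) => a Aa.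
  apply: (bsup_elim complB (F := tau a)) => [|c x ca cx].
    by rewrite bsg_total lex1.
  apply: (@le_trans _ _ (f x)); first exact: f_intro ca cx.
  by apply: (bsup_ub complB); exists x.
exists (BSingleton f_unique f_congr f_total) => a Aa.
apply: (bsup_elim complB (F := tau a)) => [|c x ca cx].
  by rewrite bsg_total lex1.
by apply: (seq_intro (x := x)) => //=; exact: f_intro cx.
Qed.

Lemma mixing_completion_mixing : mixing mixing_completion.
Proof.
(* [r] completes the antichain to a maximal one; the singleton used on it is the arbitrary value
   [tau r]. *)
move=> A tau antiA; pose r := ~` bsup A.
have rA a : A a -> a `&` r = \bot.
  move=> Aa; apply/eqP; rewrite -lex0 -le_compl complK.
  exact: (bsup_ub complB).
have antiAr : antichain (A `|` [set r]).
  move=> a b [Aa|->] [Ab|->] ab //; [exact: antiA|exact: rA|].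
  by rewrite meetC rA.
have topAr : bsup (A `|` [set r]) = \top.
  apply: le_anti; rewrite lex1 /= -(joinxC (bsup A)) leUx; apply/andP; split.
    by apply: (bsup_least complB) => a Aa; apply: (bsup_ub complB); left.
  by apply: (bsup_ub complB); right.
have [f fP] := maximal_antichain_mixing tau antiAr topAr.
by exists f => a Aa; apply: fP; left.
Qed.

End MixingCompletion.

Lemma models_Sh_BVM L V (T S : set (formula L V)) :
  models_Sh T S -> models_BVM T S.
Proof.
move=> mod d B M complB nu.
have := mod d B (mixing_completion M complB) complB
  (@mixing_completion_mixing _ _ _ M complB) (fun v => bsg_embed complB (nu v)).
pose nu' v : mixing_completion M complB := bsg_embed complB (nu v).
suff E A : [set value phi nu' | phi in A] = [set value phi nu | phi in A].
  by rewrite !E.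
(* [value_embed] covers primitive formulae, so both sides pass through [expand], which preserves
   values. *)
apply: eq_imagel => phi _; rewrite -(value_expand complB) value_embed.
  exact: value_expand.
exact: primitive_expand.
Qed.

(** * Derivations are closed under the rules *)

Section LexicographicSum.
Variables (I : eqType) (leI : rel I) (W : I -> eqType).
Variable leW : forall i, rel (W i).

(** The sum of the orders [leW i] along [leI], with [None] as a new greatest element reserved for
    the conclusion of a derivation. *)
Definition lex_le (p q : option {i : I & W i}) : bool :=
  match p, q with
  | _, None => true
  | None, Some _ => false
  | Some p, Some q =>
      if tag p == tag q then leW (tagged p) (tagged_as p q)
      else leI (tag p) (tag q)
  end.

Lemma lex_leE i u v :
  lex_le (Some (Tagged W (i := i) u)) (Some (Tagged W v)) = leW u v.
Proof. by rewrite /= eqxx tagged_asE. Qed.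

Hypotheses (woI : well_order leI) (woW : forall i, well_order (@leW i)).

Lemma well_order_antisymmetric (U : eqType) (R : rel U) :
  well_order R -> antisymmetric R.
Proof.
move=> wo x y.
exact: (@wo_chain_antisymmetric U R predT (fun A _ => wo A) x y isT isT).
Qed.

Lemma lex_le_well_order : well_order lex_le.
Proof.
apply: antisymmetric_well_order.
  move=> [[i u]|] [[j v]|] //=; rewrite (eq_sym j i); case: eqVneq => [ij|ij].
    case: j / ij v => v; rewrite !tagged_asE => uv.
    by rewrite (well_order_antisymmetric (woW (i := i)) uv).
  by move=> /(well_order_antisymmetric woI) /eqP; rewrite (negbTE ij).
move=> A [x Ax].
have [[[i u] Au]|noSome] := pselect (exists p, Some p \in A); last first.
  exists None; split.
    by case: x Ax => // p Ap; case: noSome; exists p.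
  by move=> [p|//] Ap; case: noSome; exists p.
(* First the least block that meets [A], then the least element of [A] inside that block. *)
have [i0 [[/asboolP[u0 Au0] mini0] _]] :
    exists! j, minimum_of leI
      (fun j => `[< exists v, Some (Tagged W (i := j) v) \in A >]) j.
  by apply: woI; exists i; apply/asboolP; exists u.
have [v0 [[Av0 minv0] _]] :
    exists! v, minimum_of (@leW i0) (fun v => Some (Tagged W v) \in A) v.
  by apply: woW; exists u0.
exists (Some (Tagged W v0)); split=> // -[[j v]|] //= Av.
case: eqVneq => [ij|ij]; last by apply: mini0; apply/asboolP; exists v.
by case: j / ij v Av => v Av; rewrite tagged_asE; exact: minv0.
Qed.

End LexicographicSum.

Section Derivations.
Context {L : signature} {V : Type}.
Implicit Types (q : sequent L V) (Gamma Delta : set (formula L V)).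

Lemma rule_mono (P P' : sequent L V -> Prop) q :
  (forall q', P q' -> P' q') -> rule P q -> rule P' q.
Proof.
move=> PP'; case.
- exact: r_axiom.
- by move=> ? ? ? ? phi /PP' p /PP'; exact: r_cut p.
- by move=> ? ? ? /PP'; exact: r_subst.
- by move=> ? ? ? ? /PP'; exact: r_weak.
- by move=> ? ? ? /PP'; exact: r_notL.
- by move=> ? ? ? /PP'; exact: r_notR.
- by move=> ? ? ? ? /PP'; exact: r_andL.
- by move=> ? ? ? ? Pf; apply: r_andR => i; exact/PP'.
- by move=> ? ? ? ? ? /PP'; exact: r_forallL.
- by move=> ? ? ? ? ? ? ? ? /PP'; exact: r_forallR.
- exact: r_eq_refl.
- exact: r_eq1.
- exact: r_eq2.
Qed.

Lemma derivation_primitive q : derivation q -> primitive_sequent q.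
Proof. by move=> [W [le [b [s [_ _ pf <-]]]]]; exact: (pf b).1. Qed.

(** Chosen derivations of all derivable sequents are laid end to end, with [q] on top. Any
    well-order of the blocks will do, since each block refers only to itself. Taking all derivable
    sequents treats every rule at once, even with infinitely many premises. *)
Lemma derivation_rule q :
  primitive_sequent q -> rule (@derivation L V) q -> derivation q.
Proof.
move=> primq ruleq.
pose I := {classic {q' : sequent L V | derivation q'}}.
have [leI woI] := well_ordering_principle I.
have /choice[W] : forall i : I, exists W : eqType, exists le : rel W,
    exists b : W, exists s : W -> sequent L V,
    [/\ well_order le, forall a, le a b, proof_sequence le s & s b = sval i].
  by case=> q' [W [le [b [s H]]]]; exists W, le, b, s.
move=> /(_ _)/cid-/all_sig[leW] /(_ _)/cid-/all_sig[b].
move=> /(_ _)/cid-/all_sig[s] pf.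
exists (option {i : I & W i}), (lex_le leI leW), None.
exists (fun p => if p is Some p then s (tag p) (tagged p) else q); split => //.
- by apply: lex_le_well_order => // i; case: (pf i).
- by case.
- move=> [[i u]|]; last first.
    split=> //; apply: rule_mono ruleq => q' derq'.
    pose i : I := exist _ q' derq'.
    exists (Some (Tagged W (i := i) (b i))) => //=.
    by case: (pf i).
  have [_ _ /(_ u)[primu ruleu] _] := pf i; split=> //.
  apply: rule_mono ruleu => q' [c /andP[cu ncu] <-].
  exists (Some (Tagged W c)) => //.
  rewrite lex_leE cu; apply: contraNneq ncu => -[] /eqP.
  by rewrite eq_Tagged.
Qed.

End Derivations.

(** * The complete Boolean algebra of a pole *)

(** As in phase semantics: an upward closed family of sets, read as the absurd ones, induces an
    orthogonality, and the sets equal to their double orthogonal are the facts. *)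
Record pole (F : Type) := Pole {
  bot : set (set F);
  botS : forall x y, x `<=` y -> bot x -> bot y
}.

Fact fact_display : Order.disp_t.
Proof. exact: Order.Disp tt tt. Qed.

Section Facts.
Context {F : Type}.
Variable p : pole F.
Implicit Types (A B : set (set F)) (x y : set F).

Definition perp A : set (set F) := [set x | forall y, A y -> bot p (x `|` y)].

Lemma perpS A B : A `<=` B -> perp B `<=` perp A.
Proof. by move=> AB x Bx y /AB; exact: Bx. Qed.

Lemma perp_sym A B : A `<=` perp B -> B `<=` perp A.
Proof. by move=> AB x Bx y /AB /(_ _ Bx); rewrite setUC. Qed.

Lemma sub_perpK A : A `<=` perp (perp A).
Proof. exact: perp_sym. Qed.

Lemma perp_perpK A : perp (perp (perp A)) = perp A.
Proof.
by apply/seteqP; split; [apply: perpS|]; exact: sub_perpK.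
Qed.

Lemma perp_up A x y : x `<=` y -> perp A x -> perp A y.
Proof. by move=> xy Ax z /Ax; apply: botS; exact: setSU. Qed.

Lemma bot_perp A : bot p `<=` perp A.
Proof. by move=> x px y _; apply: botS px; exact: subsetUl. Qed.

(** Union is idempotent, so a set orthogonal to itself is absurd. The same contraction yields the
    complement laws. *)
Lemma perpT : perp setT = bot p.
Proof.
apply/seteqP; split=> [x /(_ x I)|]; last exact: bot_perp.
by rewrite setUid.
Qed.

Lemma perp_bot : perp (bot p) = setT.
Proof.
apply/seteqP; split=> // x _ y; apply: botS; exact: subsetUr.
Qed.

Record fact := Fact { fval :> set (set F); fvalP : perp (perp fval) = fval }.

Definition pfact A := Fact (perp_perpK A).

Lemma fact_inj (A B : fact) : fval A = fval B -> A = B.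
Proof.
case: A B => [A AP] [B BP] /= AB; case: B / AB in BP *.
by congr Fact; exact: Prop_irrelevance.
Qed.

Lemma fact_up (A : fact) x y : x `<=` y -> fval A x -> fval A y.
Proof. by rewrite -(fvalP A); exact: perp_up. Qed.

Lemma bot_fact (A : fact) : bot p `<=` A.
Proof. by rewrite -(fvalP A); exact: bot_perp. Qed.

Lemma perp_bigcap J (D : set J) (A : J -> fact) :
  perp (perp (\bigcap_(j in D) A j)) = \bigcap_(j in D) A j.
Proof.
apply/seteqP; split; last exact: sub_perpK.
move=> x Ax j Dj; rewrite -(fvalP (A j)); apply: perpS Ax.
by apply: perpS => y; exact.
Qed.

Definition fact_bigcap J (D : set J) (A : J -> fact) := Fact (perp_bigcap D A).

Lemma perp_setI (A B : fact) : perp (perp (A `&` B)) = A `&` B.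
Proof.
apply/seteqP; split; last exact: sub_perpK.
move=> x ABx; split.
  by rewrite -(fvalP A); apply: perpS ABx; apply: perpS => y [].
by rewrite -(fvalP B); apply: perpS ABx; apply: perpS => y [].
Qed.

Lemma perp_top : perp (perp setT) = setT.
Proof. by rewrite perpT perp_bot. Qed.

Definition fact_le (A B : fact) : bool := `[< A `<=` B >].
Definition fact_meet (A B : fact) := Fact (perp_setI A B).
Definition fact_compl (A : fact) := pfact A.
(** Defined by De Morgan, as a union of facts need not be a fact. *)
Definition fact_join (A B : fact) := pfact (perp A `&` perp B).
Definition fact_top := Fact perp_top.
Definition fact_bot := pfact setT.

HB.instance Definition _ := gen_eqMixin fact.
HB.instance Definition _ := gen_choiceMixin fact.

Lemma fact_le_refl : reflexive fact_le.
Proof. by move=> A; exact/asboolP. Qed.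

Lemma fact_le_anti : antisymmetric fact_le.
Proof.
by move=> A B /andP[/asboolP AB /asboolP BA]; apply: fact_inj; apply/seteqP.
Qed.

Lemma fact_le_trans : transitive fact_le.
Proof.
by move=> A B C /asboolP AB /asboolP BC; apply/asboolP => x /AB; exact: BC.
Qed.

HB.instance Definition _ := Order.Le_isPOrder.Build fact_display fact
  fact_le_refl fact_le_anti fact_le_trans.

Lemma fact_lexI (A B C : fact) :
  (A <= fact_meet B C)%O = (A <= B)%O && (A <= C)%O.
Proof.
apply/asboolP/andP => [AI|[/asboolP AB /asboolP AC]].
  by split; apply/asboolP => x /AI[].
by move=> x Ax; split; [exact: AB|exact: AC].
Qed.

Lemma fact_leUx (A B C : fact) :
  (fact_join A B <= C)%O = (A <= C)%O && (B <= C)%O.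
Proof.
apply/asboolP/andP => [UC|[/asboolP AC /asboolP BC]].
  split; apply/asboolP => x Ax; apply: UC; move: x Ax; apply: perp_sym => x;
    by case.
rewrite /= -(fvalP C); apply: perpS => x Cx.
by split; apply: perpS Cx.
Qed.

HB.instance Definition _ := Order.POrder_MeetJoin_isLattice.Build fact_display
  fact fact_lexI fact_leUx.

(** For [x] on the left and [y] orthogonal to both meets, the union of [x] and [y] is orthogonal to
    [A] and to [B], hence to [x]; idempotence of union makes it absurd. *)
Lemma fact_meetUl : left_distributive (@Order.meet _ fact) (@Order.join _ fact).
Proof.
move=> A B C; apply: le_anti; apply/andP; split; last first.
  by rewrite leUx !leI2 ?leUl ?leUr.
suff sub : fval (fact_meet (fact_join A B) C) `<=`
           fval (fact_join (fact_meet A C) (fact_meet B C)) by exact/asboolP.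
move=> x [ABx Cx] y [ACy BCy].
(* Adding [x] to a member [z] of [D] lands in the meet of [D] and [C], to which [y] is
   orthogonal. *)
have BAy (D : fact) :
    (forall z, fval (fact_meet D C) z -> bot p (y `|` z)) -> perp D (x `|` y).
  move=> DCy z Dz; rewrite setUAC setUC; apply: DCy; split.
    by apply: fact_up Dz; exact: subsetUr.
  by apply: fact_up Cx; exact: subsetUl.
have := ABx (x `|` y) (conj (BAy A ACy) (BAy B BCy)).
by rewrite setUA setUid.
Qed.

HB.instance Definition _ := Order.Lattice_Meet_isDistrLattice.Build fact_display
  fact fact_meetUl.

Lemma fact_le0x (A : fact) : (fact_bot <= A)%O.
Proof. by apply/asboolP; rewrite /= perpT; exact: bot_fact. Qed.

Lemma fact_lex1 (A : fact) : (A <= fact_top)%O.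
Proof. exact/asboolP. Qed.

HB.instance Definition _ := Order.hasBottom.Build fact_display fact fact_le0x.
HB.instance Definition _ := Order.hasTop.Build fact_display fact fact_lex1.

Lemma fact_joinxC (A : fact) : (A `|` fact_compl A = \top)%O.
Proof.
apply: fact_inj; rewrite -[RHS]perp_bot /=; congr perp.
apply/seteqP; split=> x; last by move=> px; split; exact: bot_perp.
by move=> [Ax /(_ _ Ax)]; rewrite setUid.
Qed.

Lemma fact_meetxC (A : fact) : (A `&` fact_compl A = \bot)%O.
Proof.
apply: fact_inj => /=; rewrite perpT.
apply/seteqP; split=> x; first by move=> [Ax /(_ _ Ax)]; rewrite setUid.
by move=> px; split; [exact: bot_fact|exact: bot_perp].
Qed.

HB.instance Definition _ := Order.TBDistrLattice_hasComplement.Build fact_display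
  fact fact_joinxC fact_meetxC.

Lemma fval_compl (A : fact) : fval (~` A)%O = perp (fval A).
Proof. by []. Qed.

Lemma fval_meet (A B : fact) : fval (A `&` B)%O = fval A `&` fval B.
Proof. by []. Qed.

Lemma fact_complete : complete_lattice fact.
Proof.
move=> D; split.
  exists (pfact (perp (\bigcup_(A in D) fval A))); split.
    move=> A DA; apply/asboolP => x Ax; apply: sub_perpK; by exists A.
  move=> A ubA; apply/asboolP; rewrite -(fvalP A); do 2!apply: perpS.
  by move=> x [C /ubA/asboolP]; exact.
exists (fact_bigcap D id); split.
  by move=> A DA; apply/asboolP => x; exact.
by move=> A lbA; apply/asboolP => x Ax C /lbA/asboolP; exact.
Qed.

(** Membership in an infimum becomes pointwise, which is how conjunctions and quantifiers are
    evaluated in the term model. *)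
Lemma fval_binf J (A : J -> fact) : fval (binf (range A)) = \bigcap_j fval (A j).
Proof.
suff -> : binf (range A) = fact_bigcap setT A by [].
apply: le_anti; apply/andP; split.
  apply/asboolP => x Ax j _; suff /asboolP : (binf (range A) <= A j)%O by exact.
  by apply: (binf_lb fact_complete); exists j.
apply: (binf_greatest fact_complete) => _ [j _ <-].
by apply/asboolP => x; exact.
Qed.

End Facts.

(** * Derived rules *)

Section DerivedRules.
Context {L : signature} {V : Type}.
Implicit Types (phi psi : formula L V) (Gamma Delta : set (formula L V)).

Definition admissible W (phi : formula L W) := Linfomega phi /\ primitive phi.

Lemma derivation_admissible Gamma Delta phi :
  derivation (Gamma, Delta) -> (Gamma `|` Delta) phi -> admissible phi.
Proof. by move/derivation_primitive; exact. Qed.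

(** Inclusions absorb the explicit unions of the rule. Formulae that are added must be admissible,
    as every sequent of a derivation consists of such formulae. *)
Lemma derivation_weak Gamma Gamma' Delta Delta' :
  derivation (Gamma, Delta) -> Gamma `<=` Gamma' -> Delta `<=` Delta' ->
  Gamma' `|` Delta' `<=` @admissible V -> derivation (Gamma', Delta').
Proof.
move=> der GG DD primGD; apply: derivation_rule => //.
have <- : Gamma `|` Gamma' = Gamma' by apply/setUidPr.
have <- : Delta `|` Delta' = Delta' by apply/setUidPr.
exact: r_weak.
Qed.

Lemma derivation_axiom Gamma Delta phi :
  Gamma phi -> Delta phi -> Gamma `|` Delta `<=` @admissible V ->
  derivation (Gamma, Delta).
Proof.
move=> Gphi Dphi primGD; apply: derivation_rule => //.
have <- : Gamma `|` [set phi] = Gamma by apply/setUidPl => _ ->.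
have <- : [set phi] `|` Delta = Delta by apply/setUidPr => _ ->.
exact: r_axiom.
Qed.

Lemma derivation_cut Gamma Delta phi :
  derivation (Gamma `|` [set phi], Delta) ->
  derivation (Gamma, [set phi] `|` Delta) -> derivation (Gamma, Delta).
Proof.
move=> der1 der2; apply: derivation_rule.
  move=> psi [Gpsi|Dpsi].
    by apply: (derivation_admissible der2); left.
  by apply: (derivation_admissible der1); right.
rewrite -[Gamma]setUid -[Delta]setUid; exact: r_cut der1 der2.
Qed.

Lemma derivation_notL Gamma Delta phi :
  derivation (Gamma, [set phi] `|` Delta) ->
  derivation (Gamma `|` [set fNot phi], Delta).
Proof.
move=> der; apply: derivation_rule; last exact: r_notL.
move=> psi [[Gpsi|->]|Dpsi].
- by apply: (derivation_admissible der); left.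
- by apply: (derivation_admissible (phi := phi) der); right; left.
- by apply: (derivation_admissible der); right; right.
Qed.

Lemma derivation_notR Gamma Delta phi :
  derivation (Gamma `|` [set phi], Delta) ->
  derivation (Gamma, [set fNot phi] `|` Delta).
Proof.
move=> der; apply: derivation_rule; last exact: r_notR.
move=> psi [Gpsi|[->|Dpsi]].
- by apply: (derivation_admissible der); left; left.
- by apply: (derivation_admissible (phi := phi) der); left; right.
- by apply: (derivation_admissible der); right.
Qed.

Lemma derivation_andL Gamma Delta (J : Defs.index) (f : J -> formula L V) :
  admissible (fAnd f) -> derivation (Gamma `|` range f, Delta) ->
  derivation (Gamma `|` [set fAnd f], Delta).
Proof.
move=> goodf der; apply: derivation_rule; last exact: r_andL.
move=> psi [[Gpsi|->//]|Dpsi].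
- by apply: (derivation_admissible der); left; left.
- by apply: (derivation_admissible der); right.
Qed.

Lemma derivation_andR Gamma Delta (J : Defs.index) (f : J -> formula L V) :
  admissible (fAnd f) -> Gamma `|` Delta `<=` @admissible V ->
  (forall i, derivation (Gamma, [set f i] `|` Delta)) ->
  derivation (Gamma, [set fAnd f] `|` Delta).
Proof.
move=> goodf goodGD der; apply: derivation_rule; last exact: r_andR.
by move=> psi [Gpsi|[->//|Dpsi]]; apply: goodGD; [left|right].
Qed.

(* The conjunction is indexed by [{k | k < n}] rather than ['I_n], whose
   universe [predArgType] lies above that of the index types. *)
Lemma derivation_multicut Gamma Delta n (f : 'I_n -> formula L V) :
  (forall i, admissible (f i)) -> derivation (Gamma `|` range f, Delta) ->
  (forall i, derivation (Gamma, [set f i] `|` Delta)) ->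
  derivation (Gamma, Delta).
Proof.
move=> goodf der derf.
pose g (k : {k : nat | k < n}) := f (Ordinal (svalP k)).
have goodg : admissible (fAnd g).
  split=> [|k]; last by case: (goodf (Ordinal (svalP k))).
  split=> [k|]; first by case: (goodf (Ordinal (svalP k))).
  apply: (@sub_finite_set _ _ (\bigcup_i free_var (f i))).
    by move=> x [k _ gx]; exists (Ordinal (svalP k)).
  by apply: bigcup_finite => // i _; apply: finite_free_var; case: (goodf i).
have rangeg : range g = range f.
  apply/seteqP; split=> [_ [k _ <-]|_ [[k kn] _ <-]].
    by exists (Ordinal (svalP k)).
  by exists (exist _ k kn) => //; congr f; exact: val_inj.
(* A single cut on the conjunction replaces [n] successive cuts. *)
apply: (@derivation_cut _ _ (fAnd g)).
  by apply: derivation_andL => //; rewrite rangeg.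
apply: derivation_andR => // [psi [Gpsi|Dpsi]|k]; last exact: derf.
  by apply: (derivation_admissible der); left; left.
by apply: (derivation_admissible der); right.
Qed.

Lemma derivation_forallL Gamma Delta n (phi : formula L (V + 'I_n))
    (t : 'I_n -> term L V) :
  admissible phi -> derivation (Gamma `|` [set inst phi t], Delta) ->
  derivation (Gamma `|` [set fAll n phi], Delta).
Proof.
move=> goodphi der; apply: derivation_rule; last exact: r_forallL der.
move=> psi [[Gpsi|->]|Dpsi]; [|exact: goodphi|].
- by apply: (derivation_admissible der); left; left.
- by apply: (derivation_admissible der); right.
Qed.

Lemma derivation_forallR Gamma Delta n (phi : formula L (V + 'I_n))
    (w : 'I_n -> V) :
  admissible phi -> injective w ->
  (forall i psi, (Gamma `|` Delta) psi -> ~ free_var psi (w i)) ->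
  (forall i, ~ free_var phi (inl (w i))) ->
  derivation (Gamma, [set inst phi (fun i => Var (w i))] `|` Delta) ->
  derivation (Gamma, [set fAll n phi] `|` Delta).
Proof.
move=> goodphi injw fGD fphi der.
apply: derivation_rule; last exact: (r_forallR injw fGD fphi der).
move=> psi [Gpsi|[->|Dpsi]]; [|exact: goodphi|].
- by apply: (derivation_admissible der); left.
- by apply: (derivation_admissible der); right; right.
Qed.

Lemma admissible_inst n (phi : formula L (V + 'I_n)) t :
  admissible phi -> admissible (inst phi t).
Proof.
by move=> [inf prim]; split; [exact: Linfomega_subst|exact: primitive_subst].
Qed.

Lemma admissible_eq (s t : term L V) : admissible (fEq s t).
Proof. by []. Qed.

(** Equality 2 as an inference on the right-hand side: the equations and the instance at [t] are cut
    away from the axiom. *)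
Lemma derivation_congr Gamma Delta n (phi : formula L (V + 'I_n))
    (u t : 'I_n -> term L V) :
  admissible phi -> Gamma `|` Delta `<=` @admissible V ->
  (forall i, derivation (Gamma, [set fEq (u i) (t i)] `|` Delta)) ->
  derivation (Gamma, [set inst phi t] `|` Delta) ->
  derivation (Gamma, [set inst phi u] `|` Delta).
Proof.
move=> goodphi goodGD dereq dert.
have goodGDu : Gamma `|` ([set inst phi u] `|` Delta) `<=` @admissible V.
  move=> psi [Gpsi|[->|Dpsi]]; [|exact: admissible_inst|].
    by apply: goodGD; left.
  by apply: goodGD; right.
have goodGDu' psi : admissible psi ->
    Gamma `|` ([set psi] `|` ([set inst phi u] `|` Delta)) `<=` @admissible V.
  move=> goodpsi chi [Gchi|[->//|uchi]]; first by apply: goodGDu; left.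
  by apply: goodGDu; right.
apply: (@derivation_multicut _ _ _ (fun i => fEq (u i) (t i))).
- by [].
- apply: (@derivation_cut _ _ (inst phi t)).
    have der : derivation
        (range (fun i => fEq (u i) (t i)) `|` [set inst phi t], [set inst phi u]).
      apply: derivation_rule; last exact: r_eq2.
      by move=> psi [[[i _ <-]|->]|->] //; exact: admissible_inst.
    apply: (derivation_weak der).
    + by move=> psi [[i _ <-]|->]; [left; right; exists i|right].
    + by move=> psi ->; left.
    + move=> psi [[[Gpsi|[i _ <-//]]|->]|Dpsi]; [|exact: admissible_inst|].
        by apply: goodGDu; left.
      by apply: goodGDu; right.
  apply: (derivation_weak dert).
  + by move=> psi; left.
  + by move=> psi [->|Dpsi]; [left|right; right].
  + move=> psi [[Gpsi|[i _ <-//]]|[->|Dpsi]]; [|exact: admissible_inst|].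
      by apply: goodGDu; left.
    by apply: goodGDu; right.
- move=> i; apply: (derivation_weak (dereq i)) => //.
  + by move=> psi [->|Dpsi]; [left|right; right].
  + exact: goodGDu'.
Qed.

End DerivedRules.

(** * The term model *)

Section InfiniteSets.
Context {T : Type}.
Implicit Types A X : set T.

Lemma infinite_set_inj A :
  infinite_set A -> exists2 g : nat -> T, injective g & forall n, A (g n).
Proof.
move=> /infiniteP/card_leP[f].
exists (fun n => val (f (SigSub (mem_set (I : [set: nat] n))))).
  move=> m n /val_inj fmn.
  have [//] : SigSub (mem_set (I : [set: nat] m)) =
              SigSub (mem_set (I : [set: nat] n)).
  by apply: inj fmn; exact: mem_set.
by move=> n; apply: set_mem; exact: valP.
Qed.

Lemma infinite_set_setD A X :
  infinite_set A -> finite_set X -> infinite_set (A `\` X).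
Proof.
move=> infA finX finD; apply: infA.
apply: (@sub_finite_set _ _ ((A `\` X) `|` X)).
  by move=> x Ax; have [|] := pselect (X x); [right|left].
by rewrite finite_setU.
Qed.

(** Along an injected copy [g] of the naturals, the point at [n] moves to the point at [2n], which
    vacates the odd places. The left inverse [w'] later undoes the renaming. *)
Lemma hilbert_hotel : infinite_set [set: T] ->
  exists w w' : T -> T, cancel w w' /\ infinite_set (~` range w).
Proof.
move=> /infinite_set_inj[g injg _].
pose w x := if pselect (exists n, g n = x) is left ex
            then g (projT1 (cid ex)).*2 else x.
have wg n : w (g n) = g n.*2.
  rewrite /w; case: pselect => [ex|[]]; last by exists n.
  by case: (cid ex) => m /= /injg ->.
have wNg x : ~ (exists n, g n = x) -> w x = x by rewrite /w; case: pselect.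
have injw : injective w.
  move=> x y; have [[m <-]|Nx] := pselect (exists n, g n = x);
    have [[n <-]|Ny] := pselect (exists n, g n = y).
  - by rewrite !wg => /injg/double_inj ->.
  - by rewrite wg wNg // => gy; case: Ny; exists m.*2.
  - by rewrite wg wNg // => gx; case: Nx; exists n.*2.
  - by rewrite !wNg.
exists w, (fun y => if pselect (exists x, w x = y) is left ex
                    then projT1 (cid ex) else y); split.
  move=> x; case: pselect => [ex|[]]; last by exists x.
  by case: (cid ex) => y /= /injw.
move=> fin; apply: infinite_nat.
apply: (@sub_finite_set _ _ ((fun n => g n.*2.+1) @^-1` (~` range w))).
  move=> n _ [x _]; have [[m <-]|Nx] := pselect (exists n, g n = x).
    by rewrite wg => /injg /(congr1 odd) /=; rewrite !odd_double.
  by rewrite wNg // => gx; case: Nx; exists n.*2.+1.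
by apply: finite_preimage fin => m n _ _ /injg [/double_inj].
Qed.

End InfiniteSets.

(** * Truth values of formulae and the model of terms *)

Section TermModel.
Context {L : signature} {V : Type}.
Variables T S : set (formula L V).
Hypothesis goodTS : T `|` S `<=` @admissible L V.
Hypothesis infinite_fresh :
  infinite_set (~` \bigcup_(phi in T `|` S) free_var phi).
Implicit Types (Gamma : set (formula L V)) (phi psi : formula L V).

Definition ctx Gamma := finite_set Gamma /\ Gamma `<=` @admissible L V.

(* Contexts that are infinite or contain formulae outside the calculus count as
   absurd: this makes absurdity upward closed among all sets of formulae. *)
Definition absurd Gamma := ctx Gamma -> derivation (T `|` Gamma, S).

Lemma ctxS Gamma Gamma' : Gamma `<=` Gamma' -> ctx Gamma' -> ctx Gamma.
Proof.
move=> GG [fin goodG]; split; first exact: sub_finite_set fin.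
exact: subset_trans goodG.
Qed.

Lemma ctxU Gamma Gamma' : ctx Gamma -> ctx Gamma' -> ctx (Gamma `|` Gamma').
Proof.
move=> [fin goodG] [fin' goodG']; split; first by rewrite finite_setU.
by move=> phi [/goodG|/goodG'].
Qed.

Lemma ctx1 phi : admissible phi -> ctx [set phi].
Proof. by move=> goodphi; split; [exact: finite_set1|move=> _ ->]. Qed.

Lemma admissible_sequent Gamma Delta :
  ctx Gamma -> Delta `<=` @admissible L V ->
  (T `|` Gamma) `|` (Delta `|` S) `<=` @admissible L V.
Proof.
move=> [_ goodG] goodD phi [[Tphi|/goodG//]|[/goodD//|Sphi]].
  by apply: goodTS; left.
by apply: goodTS; right.
Qed.

Lemma admissible_sequent0 Gamma :
  ctx Gamma -> (T `|` Gamma) `|` S `<=` @admissible L V.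
Proof. by move=> ctxG; rewrite -[S]set0U; exact: admissible_sequent. Qed.

Lemma absurdS Gamma Gamma' : Gamma `<=` Gamma' -> absurd Gamma -> absurd Gamma'.
Proof.
move=> GG abs ctxG'; apply: (derivation_weak (abs (ctxS GG ctxG'))) => //.
  exact: setUS.
exact: admissible_sequent0.
Qed.

Definition absurdity : pole (formula L V) := Pole absurdS.

Local Notation entails Gamma phi := (derivation (T `|` Gamma, [set phi] `|` S)).

(** The sets that become absurd together with the negation of [phi]. In this form it is an
    orthogonal, hence a fact by construction; [truthP] identifies it with entailment. *)
Definition truth phi : fact absurdity := pfact absurdity [set [set fNot phi]].

Lemma truthP phi Gamma : admissible phi -> ctx Gamma ->
  fval (truth phi) Gamma <-> entails Gamma phi.
Proof.
move=> goodphi ctxG; have ctxN : ctx (Gamma `|` [set fNot phi]).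
  by apply: ctxU => //; exact: ctx1.
split=> [/(_ _ erefl ctxN)|ent].
  rewrite setUA => der; apply: (@derivation_cut _ _ _ _ (fNot phi)).
    apply: (derivation_weak der) => //.
    by rewrite -(setUA T); apply: admissible_sequent => // _ ->.
  apply: derivation_notR; apply: (@derivation_axiom _ _ _ _ phi);
    [by right|by left|].
  rewrite -(setUA T); apply: admissible_sequent => [|_ ->//].
  by apply: ctxU => //; exact: ctx1.
by move=> _ -> _; rewrite /= setUA; exact: derivation_notL.
Qed.

(** Sets that are not contexts are absurd and so belong to every fact; only contexts have to be
    compared. *)
Lemma fact_leP (A C : fact absurdity) :
  (forall Gamma, ctx Gamma -> fval A Gamma -> fval C Gamma) -> (A <= C)%O.
Proof.
move=> AC; apply/asboolP => Gamma AGamma.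
have [ctxG|Nctx] := pselect (ctx Gamma); first exact: AC.
by apply: bot_fact => /Nctx.
Qed.

Lemma eq_truth (A : fact absurdity) phi : admissible phi ->
  (forall Gamma, ctx Gamma -> (fval A Gamma <-> entails Gamma phi)) ->
  A = truth phi.
Proof.
move=> goodphi AP; apply: le_anti; apply/andP; split;
    apply: fact_leP => Gamma ctxG.
  by move/(AP _ ctxG)/truthP; exact.
by move/truthP => /(_ goodphi ctxG)/(AP _ ctxG).
Qed.

Lemma entails_weak Gamma Gamma' phi : Gamma `<=` Gamma' -> ctx Gamma' ->
  entails Gamma phi -> entails Gamma' phi.
Proof.
move=> GG ctxG' ent; apply: (derivation_weak ent) => //; first exact: setUS.
apply: admissible_sequent => // _ ->.
by apply: (derivation_admissible ent); right; left.
Qed.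

Lemma entails_axiom Gamma phi : ctx Gamma -> admissible phi ->
  (T `|` Gamma) phi -> entails Gamma phi.
Proof.
move=> ctxG goodphi Gphi; apply: (@derivation_axiom _ _ _ _ phi) => //.
  by left.
by apply: admissible_sequent => // _ ->.
Qed.

Lemma entails_cut Gamma phi psi : admissible psi ->
  entails (Gamma `|` [set phi]) psi -> entails Gamma phi -> entails Gamma psi.
Proof.
move=> goodpsi ent1 ent; apply: (@derivation_cut _ _ _ _ phi).
  by rewrite -(setUA T).
apply: (derivation_weak ent) => //.
  by move=> chi [->|Schi]; [left|right; right].
move=> chi [Gchi|[->|[->//|Schi]]].
- by apply: (derivation_admissible ent); left.
- by apply: (derivation_admissible ent); right; left.
- by apply: goodTS; right.
Qed.

Lemma truth_not phi : admissible phi -> (~` truth phi)%O = truth (fNot phi).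
Proof.
move=> goodphi; apply: eq_truth => // Gamma ctxG; rewrite fval_compl.
split=> [|ent Gamma' phiG' ctxGG'].
  (* Orthogonality to [truth phi] is tested on the context consisting of [phi] alone. *)
  have phiphi : fval (truth phi) [set phi].
    apply/truthP => //; first exact: ctx1.
    by apply: entails_axiom => //; [exact: ctx1|right].
  move=> /(_ _ phiphi); have ctxGphi : ctx (Gamma `|` [set phi]).
    by apply: ctxU => //; exact: ctx1.
  by move=> /(_ ctxGphi) der; apply: derivation_notR; rewrite -(setUA T).
have ctxG' : ctx Gamma' by apply: ctxS ctxGG'; exact: subsetUr.
move/truthP: phiG' => /(_ goodphi ctxG') ent'.
apply: (@derivation_cut _ _ _ _ (fNot phi)).
  apply: derivation_notL; apply: entails_weak ent' => //; exact: subsetUr.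
by apply: entails_weak ent => //; exact: subsetUl.
Qed.

Lemma truth_and (J : Defs.index) (f : J -> formula L V) : admissible (fAnd f) ->
  binf (range (fun j => truth (f j))) = truth (fAnd f).
Proof.
move=> goodand; have goodf j : admissible (f j).
  by case: goodand => -[inff _] primf; split; [exact: inff|exact: primf].
apply: eq_truth => // Gamma ctxG; rewrite fval_binf; split=> [Gf|ent j _].
  apply: derivation_andR => //; first exact: admissible_sequent0.
  by move=> j; apply/truthP => //; exact: Gf.
apply/truthP => //; apply: entails_cut ent => //.
rewrite setUA; apply: derivation_andL => //.
apply: (@derivation_axiom _ _ _ _ (f j)); [by right; exists j|by left|].
move=> psi [[Gpsi|[i _ <-//]]|Spsi].
  by apply: (admissible_sequent0 ctxG); left.
by apply: (@admissible_sequent _ [set f j] ctxG) => [_ ->//|]; right.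
Qed.

Lemma truth_all n (phi : formula L (V + 'I_n)) : admissible phi ->
  binf (range (fun t : 'I_n -> term L V => truth (inst phi t))) =
  truth (fAll n phi).
Proof.
move=> goodphi; have goodt t := admissible_inst t goodphi.
apply: eq_truth => // Gamma ctxG; rewrite fval_binf; split=> [Gphi|ent t _].
  (* The finitely many variables of [Gamma] and [phi] are to be avoided; [infinite_fresh] takes care
     of those of [T] and [S]. The instance at the fresh tuple is one of those in the infimum. *)
  pose X := (\bigcup_(psi in Gamma) free_var psi) `|`
            [set x | free_var phi (inl x)].
  have finX : finite_set X.
    rewrite finite_setU; split.
      apply: bigcup_finite => [|psi Gpsi]; first by case: ctxG.
      by apply: finite_free_var; case: (ctxG.2 psi Gpsi).
    by apply: (@finite_free_var _ _ (fAll n phi)); case: goodphi.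
  have [w injw fresh] :=
    infinite_set_inj (infinite_set_setD infinite_fresh finX).
  apply: (@derivation_forallR _ _ _ _ _ _ (fun i : 'I_n => w i)) => //.
  - by move=> i j /injw; exact: val_inj.
  - move=> i psi GSpsi psiw; have [TSfresh Xfresh] := fresh i.
    case: GSpsi => [[Tpsi|Gpsi]|Spsi].
    + by apply: TSfresh; exists psi => //; left.
    + by apply: Xfresh; left; exists psi.
    + by apply: TSfresh; exists psi => //; right.
  - by move=> i phiw; have [_] := fresh i; apply; right.
  - by apply/truthP => //; exact: Gphi.
apply/truthP => //; apply: entails_cut ent => //.
rewrite setUA; apply: (@derivation_forallL _ _ _ _ _ _ t) => //.
apply: (@derivation_axiom _ _ _ _ (inst phi t)); [by right|by left|].
rewrite -(setUA T); apply: admissible_sequent => [|_ ->//].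
  by apply: ctxU => //; exact: ctx1.
Qed.

Lemma entails_congr Gamma n (phi : formula L (V + 'I_n))
    (u t : 'I_n -> term L V) : admissible phi -> ctx Gamma ->
  (forall i, entails Gamma (fEq (u i) (t i))) ->
  entails Gamma (inst phi t) -> entails Gamma (inst phi u).
Proof.
by move=> goodphi ctxG; apply: derivation_congr => //;
  exact: admissible_sequent0.
Qed.

(* The calculus has reflexivity for variables only; for a constant it is an
   instance of [forall x, x = x]. *)
Lemma entails_refl Gamma (t : term L V) : ctx Gamma -> entails Gamma (fEq t t).
Proof.
move=> ctxG.
pose phi : formula L (V + 'I_1) := fEq (Var (inr ord0)) (Var (inr ord0)).
have [w _ _] := infinite_set_inj infinite_fresh; pose v := w 0.
have allphi : derivation (set0, [set fAll 1 phi] `|` set0).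
  apply: (@derivation_forallR _ _ _ _ _ _ (fun=> v)) => //.
  - by move=> i j _; rewrite !ord1.
  - by move=> i psi [].
  - by move=> i [].
  - apply: derivation_rule; first by move=> psi [|[->|]].
    by rewrite setU0; exact: r_eq_refl.
apply: (@entails_cut _ (fAll 1 phi)) => //.
  rewrite setUA; apply: (@derivation_forallL _ _ _ _ _ _ (fun=> t)) => //.
  apply: (@derivation_axiom _ _ _ _ (fEq t t)); [by right|by left|].
  rewrite -(setUA T); apply: admissible_sequent => [|_ ->//].
  by apply: ctxU => //; exact: ctx1.
apply: (derivation_weak allphi) => //; first by rewrite setU0; exact: subsetUl.
by apply: admissible_sequent => // _ ->.
Qed.

(** [r_eq1] speaks of variables only. For terms, symmetry follows by congruence in the formula
    [t = z], with [z] a new variable, starting from [t = t]; [up] is [t] weakened to make room for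
    [z]. *)
Lemma entails_sym Gamma (s t : term L V) : ctx Gamma ->
  entails Gamma (fEq s t) -> entails Gamma (fEq t s).
Proof.
move=> ctxG st; pose up := term_subst (fun x : V => Var (inl x : V + 'I_1)) t.
have instE r : inst (fEq up (Var (inr ord0))) (fun=> r) = fEq t r.
  by rewrite /inst /= /up; case: (t).
rewrite -instE; apply: (entails_congr (t := fun=> t)) => //.
by rewrite instE; exact: entails_refl.
Qed.

Lemma entails_trans Gamma (s t r : term L V) : ctx Gamma ->
  entails Gamma (fEq s t) -> entails Gamma (fEq t r) -> entails Gamma (fEq s r).
Proof.
move=> ctxG st tr.
pose up := term_subst (fun x : V => Var (inl x : V + 'I_1)) r.
have instE q : inst (fEq (Var (inr ord0)) up) (fun=> q) = fEq q r.
  by rewrite /inst /= /up; case: (r).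
by rewrite -instE; apply: (entails_congr (t := fun=> t)) => //; rewrite instE.
Qed.

Lemma term_inhabited : inhabited (term L V).
Proof.
by have [w _ _] := infinite_set_inj infinite_fresh; split; exact: Var (w 0).
Qed.

Definition truth_eq (s t : term L V) := truth (fEq s t).
Definition truth_rel (R : relsym L) (t : 'I_(arity R) -> term L V) :=
  truth (fRel R t).

Lemma truth_eq_refl t : truth_eq t t = \top%O.
Proof.
apply: le_anti; rewrite lex1 /=; apply: fact_leP => Gamma ctxG _.
by apply/truthP => //; exact: entails_refl.
Qed.

Lemma truth_eq_sym s t : truth_eq s t = truth_eq t s.
Proof.
apply: eq_truth => // Gamma ctxG.
by split=> [/truthP-/(_ (admissible_eq s t) ctxG)|ts]; [|apply/truthP => //];
  exact: entails_sym.
Qed.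

Lemma truth_eq_trans s t r :
  (truth_eq s t `&` truth_eq t r <= truth_eq s r)%O.
Proof.
apply: fact_leP => Gamma ctxG; rewrite fval_meet => -[/truthP st /truthP tr].
by apply/truthP => //; apply: entails_trans (st _ _) (tr _ _).
Qed.

Lemma truth_rel_congr R (s t : 'I_(arity R) -> term L V) :
  ((\meet_(i < arity R) truth_eq (s i) (t i)) `&` truth_rel s <= truth_rel t)%O.
Proof.
apply: fact_leP => Gamma ctxG; rewrite fval_meet => -[meetst /truthP Rs].
apply/truthP => //.
(* The atom with a new variable in each argument place, so that one use of congruence replaces all
   arguments. *)
pose phi : formula L (V + 'I_(arity R)) := fRel R (fun i => Var (inr i)).
apply: (@entails_congr _ _ phi t s) => //; last exact: Rs.
move=> i; apply: entails_sym => //; apply/truthP => //.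
have /asboolP :
    (\meet_(i < arity R) truth_eq (s i) (t i) <= truth_eq (s i) (t i))%O.
  exact: meets_inf.
exact.
Qed.

Definition term_model : bvmodel L (fact absurdity) :=
  BVModel term_inhabited (@Const L V) truth_eq_refl truth_eq_sym truth_eq_trans
    truth_rel_congr.

(** The truth lemma. Elements of the model are terms, so an assignment is a substitution; letting
    [W] vary allows the induction to go under quantifiers. *)
Lemma value_truth W (phi : formula L W) (s : W -> term_model) :
  admissible phi -> value phi s = truth (subst phi s).
Proof.
elim: phi s =>
  {W} [W t u|W R t|W phi IH|W J f IH|W J f IH|W n phi IH|W n phi IH]
  s [] //=.
- move=> inf prim; rewrite IH // truth_not //.
  by split; [exact: Linfomega_subst|exact: primitive_subst].
- move=> inf prim; rewrite -truth_and.
    by apply: eq_binf_range => j; apply: IH; split; [case: inf|].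
  by split; [exact: (@Linfomega_subst _ _ (fAnd f))
            |exact: (@primitive_subst _ _ (fAnd f))].
- move=> inf prim; rewrite -truth_all.
    by apply: eq_binf_range => t; rewrite IH // inst_lift_subst.
  by split; [exact: Linfomega_subst|exact: primitive_subst].
Qed.

Lemma term_model_top phi : T phi -> truth phi = \top%O.
Proof.
move=> Tphi; have goodphi : admissible phi by apply: goodTS; left.
apply: le_anti; rewrite lex1 /=; apply: fact_leP => Gamma ctxG _.
by apply/truthP => //; apply: entails_axiom => //; left.
Qed.

Lemma term_model_bot phi : S phi -> truth phi = \bot%O.
Proof.
move=> Sphi; have goodphi : admissible phi by apply: goodTS; right.
apply: le_anti; rewrite le0x andbT; apply: fact_leP => Gamma ctxG /truthP.
move=> /(_ goodphi ctxG); have -> : [set phi] `|` S = S.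
  by apply/setUidPr => _ ->.
by move=> der; rewrite [fval _]perpT.
Qed.

(** [T] and [S] enter as substitution images, so that the original sequent can be evaluated in the
    term model of a renamed one, with the renaming as assignment. *)
Lemma satisfies_derivation W (A C : set (formula L W)) (s : W -> term L V) :
  A `|` C `<=` @admissible L W ->
  [set subst chi s | chi in A] = T -> [set subst chi s | chi in C] = S ->
  satisfies term_model A C -> derivation (T, S).
Proof.
move=> goodAC AT CS /(_ s) sat.
have /asboolP topbot : (\top <= \bot :> fact absurdity)%O.
  apply: le_trans (le_trans _ sat) _.
    apply: (binf_greatest (@fact_complete _ absurdity)) => _ [phi Aphi <-].
    rewrite value_truth; last by apply: goodAC; left.
    by rewrite term_model_top // -AT; exists phi.
  apply: (bsup_least (@fact_complete _ absurdity)) => _ [phi Cphi <-].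
  rewrite value_truth; last by apply: goodAC; right.
  by rewrite term_model_bot // -CS; exists phi.
(* At the empty context, the collapse of 1 to 0 says that this context is absurd, which is the
   derivation sought. *)
have := topbot set0 I; rewrite [fval _]perpT /= /absurd setU0; apply.
by split=> [|phi []]; exact: finite_set0.
Qed.

End TermModel.

(** * Completeness *)

Lemma models_BVM_provable L V (T S : set (formula L V)) :
  infinite_set [set: V] ->
  (forall phi, T phi -> Linfomega phi) ->
  (forall phi, S phi -> Linfomega phi) ->
  models_BVM T S -> provable T S.
Proof.
move=> infV infT infS mod; have [w [w' [wK fresh]]] := hilbert_hotel infV.
pose ren (A : set (formula L V)) :=
  [set subst phi (fun v => Var (w v)) | phi in [set expand phi | phi in A]].
have goodX phi : (T `|` S) phi -> admissible (expand phi).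
  move=> TSphi; split; last exact: primitive_expand.
  by apply: Linfomega_expand; case: TSphi => [/infT|/infS].
have goodTS : ren T `|` ren S `<=` @admissible L V.
  move=> psi []; move=> [_ [phi Aphi <-] <-]; have [] := goodX phi;
    do ?[by left|by right] => inf prim;
    by split; [exact: Linfomega_subst|exact: primitive_subst].
have freshTS : infinite_set (~` \bigcup_(phi in ren T `|` ren S) free_var phi).
  (* Every free variable of a renamed formula lies in the range of [w], whose complement is
     infinite. *)
  apply: contra_not fresh; apply: sub_finite_set; apply: subsetC.
  move=> x [psi renpsi psix].
  have [phi phiE] : exists phi : formula L V,
      subst phi (fun v => Var (w v)) = psi.
    by case: renpsi => -[phi _ <-]; exists phi.
  move: psix; rewrite -phiE => fx.
  by have [y _ /= ->] := free_var_subst fx; exists y.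
have renK A : [set subst phi (fun v => Var (w' v)) | phi in ren A] =
              [set expand phi | phi in A].
  rewrite /ren image_comp -[RHS]image_id; apply: eq_imagel => phi _ /=.
  rewrite subst_comp -[RHS]subst_id; congr subst.
  by apply: funext => x /=; rewrite wK.
have der : derivation (ren T, ren S).
  apply: (satisfies_derivation (goodTS := goodTS)
    (infinite_fresh := freshTS) (A := [set expand phi | phi in T])
    (C := [set expand phi | phi in S]) (s := fun v => Var (w v))) => //.
    by move=> _ [[phi Aphi <-]|[phi Aphi <-]]; apply: goodX; [left|right].
  have complB := @fact_complete _ (absurdity goodTS).
  by move=> nu; rewrite !value_expand_image //; exact: mod.
(* The substitution rule along the left inverse [w'] turns the renamed sequent back into the
   expanded original. *)
have := r_subst w' der; rewrite !renK => ruleTS.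
apply: derivation_rule ruleTS => psi [[phi Aphi <-]|[phi Aphi <-]].
  by apply: goodX; left.
by apply: goodX; right.
Qed.

Theorem theorem3p1 (L : signature) (V : Type)
    (V_infinite : infinite_set [set: V])
    (T S : set (formula L V))
    (T_Linfomega : forall phi, T phi -> Linfomega phi)
    (S_Linfomega : forall phi, S phi -> Linfomega phi) :
  (models_Sh T S <-> models_BVM T S) /\
  (models_BVM T S <-> provable T S).
Proof.
split; split.
- exact: models_Sh_BVM.
- by move=> mod d B M complB _; exact: mod.
- exact: models_BVM_provable.
- exact: provable_models_BVM.
Qed.
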